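(* Let $q=2^s$ and $r=2^t$ with integers $s,t\ge1$, let $\ell\ge1$, $m\ge1$, $d\ge2$ be integers with $m\le\ell$, and let $\lambda\in\mathbb{F}_q^*$ with $\lambda\ne1$. Let $(\lambda_1,\dots,\lambda_\ell)\in(\mathbb{F}_q^* )^\ell$ and $(\varepsilon_1,\varepsilon_2)\in(\mathbb{F}_q^* )^2$, extend $(\lambda_n)$ to all $n\ge1$ by \[ \lambda_{\ell+rm'+1} = (\varepsilon_2/\varepsilon_1)\,\varepsilon_2^{(-1)^{m'+1}}\lambda_{m'+1}^r,\qquad \lambda_{\ell+rm'+i} = (\varepsilon_1/\varepsilon_2)^{(-1)^i}\quad (m'\ge0,\ 2\le i\le r), \] and let $\Phi := [\lambda_1T, \lambda_2T, \lambda_3T, \dots]\in\mathbb{F}_q((T^{-1}))$. (1) Assume $\lambda_1=\lambda$, $\lambda_i=1$ for all $2\le i\le m$, $\varepsilon_1=\varepsilon_2=1$, and, if $m<\ell$, $\lambda_{m+1}\ne1$. Then \[ w_2^*(\Phi)\ge\frac{m}{\ell}(r-1),\qquad w_2(\Phi)\ge 1+\frac{m}{\ell}(r-1). \] If moreover $\frac{\ell}{m}\le\frac{2(r-1)}{d+\sqrt{d^2+4(2r-1)d+4}}$, then $w_n^*(\Phi)=\frac{m}{\ell}(r-1)$ and $w_n(\Phi)=1+\frac{m}{\ell}(r-1)$ for all integers $2\le n\le d$. (2) Assume $r$ is a power of $q$, $\varepsilon_1=\varepsilon_2=1$ and $\lambda_i=\lambda$ for all $1\le i\le\ell$. Then \[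 w_2^*(\Phi)\ge r-1-\frac{r(r-1)(r-4)}{2\ell r+(r-1)(r-2)},\qquad w_2(\Phi)\ge r-\frac{r(r-1)(r-3)}{2\ell r+(r-1)(r-2)}. \] If moreover \[ 2rd\le\left(r-2-\frac{r(r-1)(r-4)}{2\ell r+(r-1)(r-2)}\right)\left(r-d-\frac{r(r-1)(r-4)}{2\ell r+(r-1)(r-2)}\right), \] then for all integers $2\le n\le d$, \[ w_n^*(\Phi)=r-1-\frac{r(r-1)(r-4)}{2\ell r+(r-1)(r-2)},\qquad w_n(\Phi)=r-\frac{r(r-1)(r-3)}{2\ell r+(r-1)(r-2)}. \]
   Context: $\mathbb{F}_q((T^{-1}))$ is the field of Laurent series $\xi=\sum_{j\ge N}a_jT^{-j}$ with absolute value $|\xi|=q^{-N}$ when $a_N\ne0$, $|0|=0$, extended uniquely to an algebraic closure. $[a_0,a_1,\dots]$ denotes a continued fraction with $a_i\in\mathbb{F}_q[T]$, $\deg_T a_j\ge1$ for $j\ge1$. (The series $\Phi$ is the unique root with $|\Phi|\ge q$ of a certain equation of the form $AX^{r+1}+BX^r+CX+D=0$ with $A,B,C,D\in\mathbb{F}_q[T]$; this is not needed for the statement.) The height $H(P)$ of $P\in(\mathbb{F}_q[T])[X]$ is the maximum absolute value of its coefficients. For $\alpha$ algebraic over $\mathbb{F}_q(T)$, its minimal polynomial is the unique non-constant irreducible primitive $P\in(\mathbb{F}_q[T])[X]$ with leading coefficient monic in $T$ and $P(\alpha)=0$; $H(\alpha):=H(P)$, $\deg\alpha:=\deg P$. For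 $n\ge1$, $w_n(\xi)$ is the supremum of real $w$ with $0<|P(\xi)|\le H(P)^{-w}$ for infinitely many $P\in(\mathbb{F}_q[T])[X]$ of degree $\le n$, and $w_n^*(\xi)$ is the supremum of real $w^*$ with $0<|\xi-\alpha|\le H(\alpha)^{-w^*-1}$ for infinitely many algebraic $\alpha$ of degree $\le n$. *)

(* Defs.v *)
From HB Require Import structures.
From mathcomp Require Import all_boot all_order all_algebra.
From mathcomp Require Import boolp classical_sets cardinality reals ereal exp.
Set Implicit Arguments.
Unset Strict Implicit.
Unset Printing Implicit Defensive.
Import Order.TTheory GRing.Theory Num.Theory.
Local Open Scope ring_scope.

Section Defs.
Variables (F : finFieldType) (R : realType).

(* The absolute value on F_q[T] (restriction of the one on F_q((T^{-1}))):
   |p| = q^(deg p), |0| = 0, with q = #|F|. *)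
Definition polyabs (p : {poly F}) : R :=
  if p == 0 then 0 else (#|F|%:R : R) ^+ (size p).-1.

Definition polyH (P : {poly {poly F}}) : R :=
  \big[Num.max/0]_(i < size P) polyabs P`_i.

(* An algebraically closed field K containing F_q[T] (hence F_q(T)),
   with a non-archimedean absolute value extending the absolute value
   |p| = q^(deg p) of F_q(T).  The algebraic closure of F_q((T^{-1}))
   with its unique extended absolute value is such a structure. *)
Record valued_closure := ValuedClosure {
  vc_field :> closedFieldType;
  vc_emb : {rmorphism {poly F} -> vc_field};
  vc_abs : vc_field -> R;
  vc_abs_ge0 : forall x, 0 <= vc_abs x;
  vc_abs_eq0 : forall x, (vc_abs x == 0) = (x == 0);
  vc_absM : forall x y, vc_abs (x * y) = vc_abs x * vc_abs y;
  vc_abs_ultra : forall x y, vc_abs (x + y) <= Num.max (vc_abs x) (vc_abs y);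
  vc_abs_emb : forall p, vc_abs (vc_emb p) = polyabs p
}.

Arguments vc_abs : clear implicits.
Arguments vc_emb : clear implicits.
Variable V : valued_closure.

Fixpoint cf_from (a : nat -> {poly F}) (k n : nat) : V :=
  match n with
  | 0 => vc_emb V (a k)
  | n'.+1 => vc_emb V (a k) + (cf_from a k.+1 n')^-1
  end.

Definition cf_limit (a : nat -> {poly F}) (xi : V) : Prop :=
  forall e : R, 0 < e -> exists N : nat,
    forall n, (N <= n)%N -> vc_abs V (xi - cf_from a 0 n) < e.

Definition peval (P : {poly {poly F}}) (xi : V) : V :=
  (map_poly (vc_emb V) P).[xi].

Definition poly_primitive (P : {poly {poly F}}) : Prop :=
  forall c : {poly F}, (forall i, c %| P`_i) -> size c = 1%N.

Definition ring_irreducible (P : {poly {poly F}}) : Prop :=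
  P != 0 /\ P \isn't a GRing.unit /\
  forall A B : {poly {poly F}}, P = A * B ->
    A \is a GRing.unit \/ B \is a GRing.unit.

Definition is_minpoly (alpha : V) (P : {poly {poly F}}) : Prop :=
  [/\ (1 < size P)%N, ring_irreducible P, poly_primitive P,
      lead_coef P \is monic & peval P alpha = 0].

Definition wn (n : nat) (xi : V) : \bar R :=
  ereal_sup [set w%:E | w in [set w : R |
    infinite_set [set P : {poly {poly F}} |
      [/\ (size P <= n.+1)%N, 0 < vc_abs V (peval P xi)
        & vc_abs V (peval P xi) <= powR (polyH P) (- w)]]]].

(* w_n^*(xi) ; H(alpha) = H(P), deg alpha = deg P with P the minimal polynomial *)
Definition wnstar (n : nat) (xi : V) : \bar R :=
  ereal_sup [set w%:E | w in [set w : R |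
    infinite_set [set alpha : V | exists P : {poly {poly F}},
      [/\ is_minpoly alpha P, (size P <= n.+1)%N, 0 < vc_abs V (xi - alpha)
        & vc_abs V (xi - alpha) <= powR (polyH P) (- w - 1)]]]].

End Defs.
Arguments vc_abs {F R} _ _.
Arguments vc_emb {F R} _.

(* Main.v *)
Require Import Defs.
From HB Require Import structures.
From mathcomp Require Import all_boot all_order all_algebra.
From mathcomp Require Import boolp classical_sets cardinality reals ereal exp.
From mathcomp Require Import polyXY finfield ring lra zify.
Import Order.TTheory GRing.Theory Num.Theory.
Local Open Scope ring_scope.
Local Open Scope ereal_scope.
Local Open Scope ring_scope.
Set Implicit Arguments.
Unset Strict Implicit.
Unset Printing Implicit Defensive.

(** The expansion of [Phi] contains blocks along which it agrees with an
eventually periodic expansion, hence with a quadratic number.  In terms of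
complete quotients [x_n = a_n + 1 / x_(n+1)], a quadratic form at [x_(n+1)] is
pulled back to one at [x_n] by an explicit unimodular substitution which, in
characteristic 2, fixes the middle coefficient.  Starting from the form of the
periodic part this yields primitive quadratics [G_k] whose height, middle
coefficient and value at [Phi] are known exactly.  Again because the
characteristic is 2, the difference of the two roots of [a X^2 + b X + c] is
[b / a], so that these data give the distances from [Phi] to both roots, and
the lower bounds follow.

All partial quotients have degree 1, so [Phi] is badly approximable by rational
functions and [G_k] is irreducible for large [k].  For the upper bounds, a
polynomial [P] coprime to every [G_k] satisfies [1 <= |Res (P, G_k)|]; with [k]
minimal such that the height of [G_k] exceeds a suitable power of that of [P],
this bounds [|P (Phi)|] from below.  The remaining [P] are handled by dividing
out the [G_k], the height being multiplicative. *)

(** * Absolute value and height *)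

(** Two exponents describe each form. If its height is q^h, the near root lies at distance about
    q^(-(1+w)h) from [Phi], the far root at about q^(-vh), and |G_k(Phi)| is about q^(-(w+v)h). As
    the roots differ by b / a, the middle coefficient then has size about q^((1-v)h). In case (1) it
    is always T, so v = 1; in case (2) it is T^(r^(k+1) - 1), whose degree is a fixed proportion of
    h, so v < 1. This explains the different gaps between w_n and w_n^* in the two cases. Every
    estimate holds up to a bounded factor q^K, which disappears in the suprema. The obstacle is the
    upper bound: a resultant says something about P only if the height of G_k is comparable with a
    power of that of P, so the heights of successive forms must not be too far apart; they grow at
    most to the power r, up to a constant factor. With D = 1 + w + v - n, both numerical hypotheses
    on d enter only through D > 0 and 2r(n - v) <= D(w - 1). *)

Section AbsoluteValue.
Variables (F : finFieldType) (R : realType).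
Implicit Types (p c : {poly F}) (P Q : {poly {poly F}}).

(** Real exponents in base q turn products of absolute values into sums, so that estimates become
    linear inequalities between exponents. *)
Definition qexp (e : R) : R := powR #|F|%:R e.

Lemma card_gt1R : 1 < #|F|%:R :> R.
Proof. by rewrite ltr1n card_finNzRing_gt1. Qed.

Lemma qexp_gt0 e : 0 < qexp e.
Proof. by rewrite powR_gt0 // (lt_trans ltr01) // card_gt1R. Qed.

Lemma qexp_ge0 e : 0 <= qexp e.
Proof. exact/ltW/qexp_gt0. Qed.

Lemma qexpD a b : qexp (a + b) = qexp a * qexp b.
Proof.
by rewrite /qexp powRD // (gt_eqF (lt_trans ltr01 card_gt1R)) implybT.
Qed.

Lemma qexp0 : qexp 0 = 1.
Proof. by rewrite /qexp powRr0. Qed.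

Lemma qexpN a : qexp (- a) = (qexp a)^-1.
Proof. by rewrite /qexp powRN. Qed.

Lemma qexpM a b : powR (qexp a) b = qexp (a * b).
Proof. by rewrite /qexp powRrM. Qed.

Lemma qexp_nat n : qexp n%:R = #|F|%:R ^+ n.
Proof. by rewrite /qexp powR_mulrn // ler0n. Qed.

Lemma qexp_exp a n : qexp a ^+ n = qexp (n%:R * a).
Proof. by rewrite mulrC -qexpM powR_mulrn // qexp_ge0. Qed.

Lemma ler_qexp a b : (qexp a <= qexp b) = (a <= b).
Proof.
have q1 := card_gt1R.
apply/idP/idP => [|ab]; last by rewrite /qexp ler_powR // ltW.
have q0 : 0 < #|F|%:R :> R by apply: lt_trans q1.
rewrite -(@ler_ln R) ?posrE ?qexp_gt0 // /qexp !ln_powR ler_pM2r //.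
exact: ln_gt0.
Qed.

Lemma ltr_qexp a b : (qexp a < qexp b) = (a < b).
Proof. by rewrite !ltNge ler_qexp. Qed.

Lemma qexp_le1 e : (qexp e <= 1) = (e <= 0).
Proof. by rewrite -qexp0 ler_qexp. Qed.

Lemma qexpP (x : R) : 0 < x -> exists e, x = qexp e.
Proof.
move=> x0; exists (ln x / ln #|F|%:R).
have q1 := card_gt1R; have q0 := lt_trans ltr01 q1.
rewrite /qexp /powR gt_eqF // divfK ?lnK ?posrE // gt_eqF //.
exact: ln_gt0.
Qed.

Definition pdeg (p : {poly F}) : R := ((size p).-1)%:R.

Lemma polyabsE p : p != 0 -> polyabs R p = qexp (pdeg p).
Proof. by move=> p0; rewrite /polyabs (negPf p0) /pdeg qexp_nat. Qed.

(** The logarithm of H(P) in base q, which is the degree of P in T; the zero polynomial gets the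
    value 0. *)
Definition ht (P : {poly {poly F}}) : R := ((sizeY P).-1)%:R.

Lemma ht_ge0 P : 0 <= ht P.
Proof. exact: ler0n. Qed.

Lemma polyHE P : P != 0 -> polyH R P = qexp (ht P).
Proof.
move=> P0; apply/le_anti/andP; split.
  apply/bigmax_leP; split=> [|i _]; first exact: qexp_ge0.
  have [->|Pi0] := eqVneq P`_i 0; first by rewrite /polyabs eqxx qexp_ge0.
  rewrite polyabsE // ler_qexp ler_nat.
  by have := max_size_coefXY P i; case: (size _) => // ?; case: (sizeY P).
have [|i Ei] := @bigop.eq_bigmax _ (fun i : 'I_(size P) => size P`_i).
  by rewrite card_ord size_poly_gt0.
have Pi0 : P`_i != 0.
  by rewrite -size_poly_gt0 -Ei lt0n sizeY_eq0.
have -> : qexp (ht P) = polyabs R P`_i.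
  by rewrite polyabsE // /ht /sizeY Ei.
exact: (@le_bigmax _ R _ 0 (fun i : 'I_(size P) => polyabs R P`_i)).
Qed.

(** After [swapXY] the degree in T is an ordinary degree over an integral domain, hence additive. *)
Lemma htM P Q : P != 0 -> Q != 0 -> ht (P * Q) = ht P + ht Q.
Proof.
move=> P0 Q0; rewrite /ht !sizeYE rmorphM /= size_mul ?swapXY_eq0 //.
have := swapXY_eq0 P; have := swapXY_eq0 Q.
rewrite -![swapXY _ == 0]size_poly_eq0 (negPf P0) (negPf Q0) -natrD.
by case: (size _) => // a; case: (size _) => // b _ _; rewrite addnS addSn.
Qed.

Lemma ht1 : ht 1 = 0.
Proof.
apply: (@addrI _ (ht 1)).
by rewrite addr0 -htM ?oner_neq0 // mulr1.
Qed.

Lemma pdeg_le_ht (P : {poly {poly F}}) i : pdeg P`_i <= ht P.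
Proof.
rewrite ler_nat.
by have := max_size_coefXY P i; case: (size _) => // ?; case: (sizeY P).
Qed.

Variable V : valued_closure F R.
Local Notation abs := (vc_abs V).
Local Notation emb := (vc_emb V).
Implicit Types x y z : V.

Lemma abs0 : abs 0 = 0.
Proof. by apply/eqP; rewrite vc_abs_eq0. Qed.

Lemma abs_gt0 x : (0 < abs x) = (x != 0).
Proof. by rewrite lt_neqAle vc_abs_ge0 andbT eq_sym vc_abs_eq0. Qed.

Lemma abs1 : abs 1 = 1.
Proof.
have : abs 1 * abs 1 = abs 1 * 1 by rewrite -vc_absM !mulr1.
by move/mulfI; apply; rewrite vc_abs_eq0 oner_eq0.
Qed.

Lemma absN x : abs (- x) = abs x.
Proof.
have h : abs (-1) = 1.
  have : abs (-1) ^+ 2 = 1 ^+ 2 by rewrite expr2 -vc_absM mulrNN mulr1 abs1 expr1n.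
  by move/eqP; rewrite eqrXn2 // ?vc_abs_ge0 // => /eqP.
by rewrite -mulN1r vc_absM h mul1r.
Qed.

Lemma absV x : abs x^-1 = (abs x)^-1.
Proof.
have [->|x0] := eqVneq x 0; first by rewrite invr0 abs0 invr0.
apply: (@mulfI _ (abs x)); first by rewrite vc_abs_eq0.
by rewrite -vc_absM !divff ?abs1 // vc_abs_eq0.
Qed.

Lemma absX x n : abs (x ^+ n) = abs x ^+ n.
Proof. by elim: n => [|n IH]; rewrite ?expr0 ?abs1 // !exprS vc_absM IH. Qed.

Lemma abs_subC x y : abs (x - y) = abs (y - x).
Proof. by rewrite -absN opprB. Qed.

Lemma absD_le x y e : abs x <= e -> abs y <= e -> abs (x + y) <= e.
Proof. by move=> hx hy; apply: le_trans (vc_abs_ultra _ _) _; rewrite ge_max hx. Qed.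

Lemma absB_le x y e : abs x <= e -> abs y <= e -> abs (x - y) <= e.
Proof. by move=> hx hy; apply: absD_le => //; rewrite absN. Qed.

Lemma absD_lt x y e : abs x < e -> abs y < e -> abs (x + y) < e.
Proof. by move=> hx hy; apply: le_lt_trans (vc_abs_ultra _ _) _; rewrite gt_max hx. Qed.

Lemma abs_sum_le (I : Type) (r : seq I) (p : pred I) (f : I -> V) e :
  0 <= e -> (forall i, p i -> abs (f i) <= e) -> abs (\sum_(i <- r | p i) f i) <= e.
Proof.
move=> e0 h; elim/big_rec: _ => [|i x pi hx]; first by rewrite abs0.
by apply: absD_le => //; apply: h.
Qed.

Lemma absD_dom x y : abs y < abs x -> abs (x + y) = abs x.
Proof.
move=> yx; apply/le_anti/andP; split.
  by apply: absD_le => //; exact: ltW.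
rewrite leNgt; apply/negP => h.
have : abs (x + y - y) < abs x by apply: absD_lt => //; rewrite absN.
by rewrite addrK ltxx.
Qed.

Lemma absM_le x y a b :
  abs x <= qexp a -> abs y <= qexp b -> abs (x * y) <= qexp (a + b).
Proof.
by move=> hx hy; rewrite vc_absM qexpD ler_pM // vc_abs_ge0.
Qed.

Lemma absX_le x a n : abs x <= qexp a -> abs (x ^+ n) <= qexp (n%:R * a).
Proof.
by move=> hx; rewrite absX -qexp_exp lerXn2r ?nnegrE ?vc_abs_ge0 ?qexp_ge0.
Qed.

Lemma abs_emb p : p != 0 -> abs (emb p) = qexp (pdeg p).
Proof. by move=> p0; rewrite vc_abs_emb polyabsE. Qed.

Lemma abs_emb_le p a : pdeg p <= a -> abs (emb p) <= qexp a.
Proof.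
move=> pa; have [->|p0] := eqVneq p 0; first by rewrite rmorph0 abs0 qexp_ge0.
by rewrite abs_emb // ler_qexp.
Qed.

Lemma emb_eq0 p : (emb p == 0) = (p == 0).
Proof.
rewrite -vc_abs_eq0 vc_abs_emb; have [->|p0] := eqVneq p 0.
  by rewrite /polyabs !eqxx.
by rewrite polyabsE // gt_eqF // qexp_gt0.
Qed.

Lemma emb_inj : injective emb.
Proof.
by move=> a b ab; apply/eqP; rewrite -subr_eq0 -emb_eq0 rmorphB ab subrr.
Qed.

Lemma closure_char2 : 2%:R = 0 :> F -> 2%:R = 0 :> V.
Proof.
move=> F2; have <- : emb (2%:R : F)%:P = 2%:R by rewrite polyCMn !rmorphMn rmorph1.
by rewrite F2 polyC0 rmorph0.
Qed.

Lemma abs_emb_ge1 p : p != 0 -> 1 <= abs (emb p).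
Proof. by move=> p0; rewrite abs_emb // -qexp0 ler_qexp ler0n. Qed.

Lemma pevalE P x n : (size P <= n)%N ->
  peval P x = \sum_(i < n) emb P`_i * x ^+ i.
Proof.
move=> sP; rewrite /peval (@horner_coef_wide _ n) ?size_map_inj_poly //.
- by apply: eq_bigr => i _; rewrite coef_map.
- exact: emb_inj.
- by rewrite rmorph0.
Qed.

Lemma pevalM P Q x : peval (P * Q) x = peval P x * peval Q x.
Proof. by rewrite /peval rmorphM hornerM. Qed.

Lemma pevalB P Q x : peval (P - Q) x = peval P x - peval Q x.
Proof. by rewrite /peval rmorphB !hornerE. Qed.

Lemma pevalD P Q x : peval (P + Q) x = peval P x + peval Q x.
Proof. by rewrite /peval rmorphD !hornerE. Qed.

Lemma pevalC c x : peval c%:P x = emb c.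
Proof. by rewrite /peval map_polyC hornerC. Qed.

Lemma pevalX x : peval 'X x = x.
Proof. by rewrite /peval map_polyX hornerX. Qed.

Lemma pevalZ c P x : peval (c *: P) x = emb c * peval P x.
Proof. by rewrite -mul_polyC pevalM pevalC. Qed.

(** Each monomial contributes x^i - y^i = (x - y) times a sum of products x^(i-1-j) y^j, and the
    ultrametric inequality costs nothing for the number of terms. *)
Lemma peval_diff_le P x y n K e : (size P <= n.+1)%N -> 0 <= K ->
  abs x <= qexp K -> abs y <= qexp K -> abs (x - y) <= e ->
  abs (peval P x - peval P y) <= e * qexp (ht P + n%:R * K).
Proof.
move=> sP K0 hx hy hxy.
have e0 : 0 <= e by apply: le_trans hxy; rewrite vc_abs_ge0.
rewrite !(@pevalE _ _ n.+1) // -sumrB; apply: abs_sum_le => [|i _].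
  by rewrite mulr_ge0 // qexp_ge0.
rewrite -mulrBr subrXX mulrCA vc_absM.
apply: ler_pM; rewrite ?vc_abs_ge0 // absM_le ?abs_emb_le ?pdeg_le_ht //.
apply: abs_sum_le => [|j _]; first exact: qexp_ge0.
(* As K is nonnegative, the total degree i - 1 may be padded up to n. *)
have -> : n%:R * K = (i.-1 - j)%:R * K + (n - (i.-1 - j))%:R * K.
  by rewrite -mulrDl -natrD subnKC //; have := ltn_ord i; lia.
apply: absM_le; first exact: absX_le.
apply: le_trans (absX_le _ hy) _; rewrite ler_qexp ler_wpM2r // ler_nat.
have := ltn_ord i; have := ltn_ord j; lia.
Qed.

End AbsoluteValue.

(** * Gauss's lemma and quadratic polynomials *)

Section Gauss.
Variable F : fieldType.
Implicit Types p a b : {poly F}.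

Lemma irreducible_divisor p : (1 < size p)%N ->
  exists r, irreducible_poly r /\ r %| p.
Proof.
have [n] := ubnP (size p); elim: n p => // n IH p ltn sp.
have [pi|] := pselect (irreducible_poly p); first by exists p.
move=> npi.
have [q [q1 qp nqp]] : exists q : {poly F}, [/\ size q != 1%N, q %| p & ~~ (q %= p)].
  apply: contrapT => h; apply: npi; split=> // q q1 qp.
  by apply: contrapT => nqp; apply: h; exists q; split=> //; apply/negP.
have p0 : p != 0 by rewrite -size_poly_gt0; case: (size p) sp.
have q0 : q != 0 by apply: contraNneq p0 => q0; move: qp; rewrite q0 dvd0p.
have lqp : (size q < size p)%N.
  by rewrite ltn_neqAle dvdp_leq // andbT dvdp_size_eqp.
have [||r [ri rq]] := IH q; first exact: leq_trans lqp _.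
  by rewrite ltn_neqAle eq_sym q1 size_poly_gt0.
by exists r; split=> //; apply: dvdp_trans qp.
Qed.

Lemma irreducible_dvd_mul p a b : irreducible_poly p ->
  p %| a * b -> (p %| a) || (p %| b).
Proof.
move=> pi pab; case: (boolP (p %| a)) => //= npa.
by rewrite -(Gauss_dvdpr _ (_ : coprimep p a)) // irreducible_poly_coprime.
Qed.

(** Gauss's argument: if i and j are the first indices at which [p] fails to divide the coefficients
    of Q and G, then all terms but one of coefficient i + j of Q * G are divisible by [p]. *)
Lemma irreducible_dvd_coef p (Q G : {poly {poly F}}) : irreducible_poly p ->
  (forall i, p %| (Q * G)`_i) -> (exists j, ~~ (p %| G`_j)) ->
  forall i, p %| Q`_i.
Proof.
move=> pi pQG exG i; apply: contrapT => /negP nQi.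
have exQ : exists i, ~~ (p %| Q`_i) by exists i.
clear i nQi.
case: (ex_minnP exQ) => i nQi mini; case: (ex_minnP exG) => j nGj minj.
have := pQG (i + j)%N; rewrite coefM.
have lt_i : (i < (i + j).+1)%N by rewrite ltnS leq_addr.
rewrite (bigD1 (Ordinal lt_i)) //= dvdp_addl.
  rewrite addKn => /(irreducible_dvd_mul pi).
  by rewrite (negPf nQi) (negPf nGj).
apply: (big_ind (fun x : {poly F} => p %| x)) => [|x y|k]; [exact: dvdp0|exact: dvdp_add|].
rewrite -val_eqE /= => nki.
have [ki|] := ltnP k i.
  by rewrite dvdp_mulr //; apply: contraLR ki => /mini; rewrite -leqNgt.
rewrite leq_eqVlt eq_sym (negPf nki) /= => ik.
rewrite dvdp_mull //; apply: contrapT => /negP /minj.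
by have := ltn_ord k; lia.
Qed.

(** Induction on the degree of s: since G is primitive, an irreducible factor of s divides every
    coefficient of Q and can be cancelled. *)
Lemma primitive_dvd_scale (s : {poly F}) (P Q G : {poly {poly F}}) :
  (forall c, (forall i, c %| G`_i) -> size c = 1%N) ->
  s != 0 -> s *: P = Q * G -> exists Q', P = Q' * G.
Proof.
move=> primG; have [n] := ubnP (size s); elim: n s Q => // n IH s Q ltn s0 E.
have [s1|s1] := leqP (size s) 1.
  have Es := size1_polyC s1; set c := s`_0 in Es.
  have c0 : c != 0 by move: s0; rewrite Es polyC_eq0.
  exists (c^-1%:P *: Q); rewrite -scalerAl -E scalerA Es -polyCM mulVf //.
  by rewrite scale1r.
have [p [pi /dvdpP [t Et]]] := irreducible_divisor s1.
have p0 := irredp_neq0 pi.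
have t0 : t != 0 by apply: contraNneq s0 => t0; rewrite Et t0 mul0r.
have pQG i : p %| (Q * G)`_i by rewrite -E coefZ Et mulrAC dvdp_mulIr.
have nG : exists j, ~~ (p %| G`_j).
  apply: contrapT => h; have := primG p.
  case: (pi) => p1 _; rewrite (_ : size p = 1%N) in p1 => //; apply: primG => j.
  by apply: contrapT => /negP nj; apply: h; exists j.
have pQ := irreducible_dvd_coef pi pQG nG.
pose Q1 := \poly_(i < size Q) (Q`_i %/ p).
have EQ : Q = p *: Q1.
  apply/polyP => i; rewrite coefZ coef_poly.
  case: ltnP => [_|/(nth_default 0) ->]; last by rewrite mulr0.
  by rewrite mulrC divpK.
apply: (IH t Q1) => //.
  rewrite -ltnS (leq_trans _ ltn) // Et size_mul // ltnS.
  by case: (pi) => p1 _; case: (size p) p1 => // -[] // k _; rewrite !addnS ltnS leq_addr.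
apply/polyP => i; apply: (@mulfI _ p) => //.
move/polyP: E => /(_ i); rewrite EQ -scalerAl !coefZ => <-.
by rewrite Et mulrCA mulrA.
Qed.

End Gauss.

Section Roots.
Variables (F : finFieldType) (R : realType) (V : valued_closure F R).
Local Notation abs := (vc_abs V).
Local Notation emb := (vc_emb V).
Implicit Types (x y al be : V) (a b c u v : {poly F}) (P : {poly {poly F}}).

(** The pseudo-remainder of P by G vanishes at x and has smaller degree, so it is 0;
    [primitive_dvd_scale] then removes the power of the leading coefficient introduced by
    pseudo-division. *)
Lemma primitive_root_dvd (x : V) (G P : {poly {poly F}}) :
  poly_primitive G -> peval G x = 0 ->
  (forall r : {poly {poly F}}, (size r < size G)%N -> peval r x = 0 -> r = 0) ->
  peval P x = 0 -> exists Q, P = Q * G.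
Proof.
move=> primG Gx minG Px.
have G0 : G != 0.
  apply/eqP => G0; suff /primG : forall i, (0 : {poly F}) %| G`_i by rewrite size_poly0.
  by move=> i; rewrite G0 coef0 dvdp0.
have E := Pdiv.Idomain.divp_eq P G.
have r0 : P %% G = 0.
  apply: minG; first by rewrite ltn_modp.
  have -> : P %% G = lead_coef G ^+ scalp P G *: P - P %/ G * G.
    by rewrite E addrC addKr.
  by rewrite pevalB pevalM pevalZ Px Gx !mulr0 subr0.
apply: (primitive_dvd_scale primG (s := lead_coef G ^+ scalp P G) (Q := P %/ G)).
  by rewrite expf_neq0 // lead_coef_eq0.
by rewrite E r0 addr0.
Qed.

Definition quad a b c : {poly {poly F}} := a *: 'X^2 + b *: 'X + c%:P.

Lemma peval_quad a b c x :
  peval (quad a b c) x = emb a * x ^+ 2 + emb b * x + emb c.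
Proof. by rewrite /quad !pevalD !pevalZ pevalC expr2 pevalM pevalX. Qed.

Lemma coef_quad a b c i :
  (quad a b c)`_i = if i == 0%N then c else if i == 1%N then b
                    else if i == 2%N then a else 0.
Proof.
rewrite /quad !coefD !coefZ coefXn coefX coefC.
by case: i => [|[|[|i]]] /=; rewrite ?mulr0 ?mulr1 ?add0r ?addr0.
Qed.

Lemma size_quad a b c : a != 0 -> size (quad a b c) = 3%N.
Proof.
move=> a0; apply/eqP; rewrite eqn_leq; apply/andP; split.
  by apply/leq_sizeP => -[|[|[|i]]] // _; rewrite coef_quad.
rewrite ltnNge; apply/negP => /leq_sizeP /(_ 2%N (leqnn _)).
by rewrite coef_quad /=; apply/eqP.
Qed.

Lemma lead_coef_quad a b c : a != 0 -> lead_coef (quad a b c) = a.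
Proof. by move=> a0; rewrite lead_coefE size_quad // coef_quad. Qed.

Lemma sizeY_quad a b c :
  sizeY (quad a b c) = maxn (size c) (maxn (size b) (size a)).
Proof.
apply/eqP; rewrite eqn_leq; apply/andP; split.
  apply/bigmax_leqP => i _; rewrite coef_quad.
  case: (val i) => [|[|[|j]]] /=; rewrite ?leq_max ?leqnn ?orbT //.
  by rewrite size_poly0.
rewrite !geq_max; apply/and3P; split.
- by have := max_size_coefXY (quad a b c) 0; rewrite coef_quad.
- by have := max_size_coefXY (quad a b c) 1; rewrite coef_quad.
- by have := max_size_coefXY (quad a b c) 2; rewrite coef_quad.
Qed.

(** A Bezout relation is stronger than primitivity and is carried along explicitly by the
    substitutions between forms. *)
Definition unimodular a b c := exists u v w, u * a + v * b + w * c = 1.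

Lemma unimodular_primitive a b c :
  unimodular a b c -> poly_primitive (quad a b c).
Proof.
move=> [u [v [w E]]] d hd.
apply/eqP; rewrite -dvdp1 -E.
have := hd 0%N; have := hd 1%N; have := hd 2%N; rewrite !coef_quad /= => ha hb hc.
by rewrite !dvdp_add ?dvdp_mull.
Qed.

Lemma quad_roots a b c : a != 0 -> exists al be,
  emb b = - (emb a * (al + be)) /\ emb c = emb a * (al * be).
Proof.
move=> a0; have ea0 : emb a != 0 by rewrite emb_eq0.
have [rs Ers] := closed_field_poly_normal (map_poly emb (quad a b c)).
have lE : lead_coef (map_poly emb (quad a b c)) = emb a.
  by rewrite lead_coef_map_inj ?lead_coef_quad ?rmorph0 //; exact: emb_inj.
have := f_equal (fun p : {poly V} => size p) Ers.
rewrite size_map_inj_poly ?rmorph0 //; last exact: emb_inj.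
rewrite size_quad // lE size_scale // size_prod_XsubC => -[].
case: rs Ers => [|al [|be [|]]] // + _; rewrite lE !big_cons big_nil mulr1.
move=> /polyP E; exists al, be.
have e0 := E 0%N; have e1 := E 1%N; move: e0 e1.
rewrite !coef_map !coef_quad /= => -> ->.
have -> : ('X - al%:P) * ('X - be%:P) = 'X^2 - (al + be) *: 'X + (al * be)%:P.
  by rewrite -mul_polyC polyCD polyCM; ring.
rewrite !coefZ !(coefD, coefN, coefZ, coefC, coefX, coefXn) /=; split; ring.
Qed.

Definition integral_at x := exists u, x = emb u.

Lemma integral_emb u : integral_at (emb u). Proof. by exists u. Qed.
Lemma integralD x y : integral_at x -> integral_at y -> integral_at (x + y).
Proof. by move=> [u ->] [v ->]; exists (u + v); rewrite rmorphD. Qed.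
Lemma integralN x : integral_at x -> integral_at (- x).
Proof. by move=> [u ->]; exists (- u); rewrite rmorphN. Qed.
Lemma integralM x y : integral_at x -> integral_at y -> integral_at (x * y).
Proof. by move=> [u ->] [v ->]; exists (u * v); rewrite rmorphM. Qed.
Lemma integral_sum (I : finType) (f : I -> V) :
  (forall i, integral_at (f i)) -> integral_at (\sum_i f i).
Proof.
by move=> h; elim/big_ind: _ => //; [rewrite -(rmorph0 emb); exact: integral_emb|exact: integralD].
Qed.

(** Newton's recurrence s_(n+2) = (al + be) s_(n+1) - al be s_n, multiplied by a^(n+2), has
    coefficients in F_q[T]; hence the induction on two consecutive sums. *)
Lemma integral_power_sum a b c al be n : emb b = - (emb a * (al + be)) ->
  emb c = emb a * (al * be) ->
  integral_at (emb a ^+ n * (al ^+ n + be ^+ n)).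
Proof.
move=> hb hc; suff: integral_at (emb a ^+ n * (al ^+ n + be ^+ n)) /\
  integral_at (emb a ^+ n.+1 * (al ^+ n.+1 + be ^+ n.+1)) by case.
elim: n => [|n [IH1 IH2]].
  split; first by rewrite !expr0 mul1r -(rmorph1 emb) -rmorphD; exact: integral_emb.
  by rewrite !expr1 -[_ * _]opprK -hb -rmorphN; exact: integral_emb.
split=> //.
have -> : emb a ^+ n.+2 * (al ^+ n.+2 + be ^+ n.+2) =
  - emb b * (emb a ^+ n.+1 * (al ^+ n.+1 + be ^+ n.+1)) -
  (emb a * emb c) * (emb a ^+ n * (al ^+ n + be ^+ n)).
  rewrite hb hc !exprS; ring.
apply: integralD; first by apply: integralM => //; apply/integralN/integral_emb.
apply: integralN; apply: integralM => //; apply: integralM; exact: integral_emb.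
Qed.

(** This is the resultant of the quadratic with P taken in formal degree n. Peeling off the constant
    coefficient of P avoids determinants: the mixed terms are combinations of scaled power sums. *)
Lemma integral_norm a b c al be P n : emb b = - (emb a * (al + be)) ->
  emb c = emb a * (al * be) -> (size P <= n.+1)%N ->
  integral_at (emb a ^+ n * (peval P al * peval P be)).
Proof.
move=> hb hc; elim: n P => [|n IH] P sP.
  rewrite (size1_polyC sP) !pevalC expr0 mul1r -rmorphM; exact: integral_emb.
pose P' := \poly_(i < n.+1) P`_i.+1.
have sP' : (size P' <= n.+1)%N by exact: size_poly.
have EP : P = 'X * P' + (P`_0)%:P.
  apply/polyP => -[|i]; rewrite coefD coefXM coefC /= ?add0r // addr0 coef_poly.
  by case: ltnP => // h; rewrite nth_default //; apply: leq_trans sP _.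
have Px x : peval P x = x * peval P' x + emb P`_0.
  by rewrite {1}EP pevalD pevalM pevalX pevalC.
have -> : emb a ^+ n.+1 * (peval P al * peval P be) =
  emb c * (emb a ^+ n * (peval P' al * peval P' be)) +
  emb P`_0 * (emb a ^+ n.+1 * (al * peval P' al + be * peval P' be)) +
  emb a ^+ n.+1 * (emb P`_0 * emb P`_0).
  rewrite !Px hc exprS; ring.
have int_a k : integral_at (emb a ^+ k) by rewrite -rmorphXn; exact: integral_emb.
apply: integralD; last by apply: integralM => //; apply: integralM; exact: integral_emb.
apply: integralD; first by apply: integralM; [exact: integral_emb|exact: IH].
apply: integralM; first exact: integral_emb.
rewrite !(pevalE _ sP') !mulr_sumr -big_split mulr_sumr; apply: integral_sum => i /=.
have -> : emb a ^+ n.+1 * (al * (emb P'`_i * al ^+ i) + be * (emb P'`_i * be ^+ i)) =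
  emb P'`_i * emb a ^+ (n - i) * (emb a ^+ i.+1 * (al ^+ i.+1 + be ^+ i.+1)).
  have -> : emb a ^+ n.+1 = emb a ^+ (n - i) * emb a ^+ i.+1.
    by rewrite -exprD addnS subnK // -ltnS.
  rewrite !exprS; ring.
apply: integralM; last exact: integral_power_sum hb hc.
by apply: integralM => //; exact: integral_emb.
Qed.

Lemma integral_ge1 x : integral_at x -> x != 0 -> 1 <= abs x.
Proof. by move=> [u ->]; rewrite emb_eq0; exact: abs_emb_ge1. Qed.

End Roots.

Section QuadraticRoots.
Variables (F : finFieldType) (R : realType) (V : valued_closure F R).
Local Notation abs := (vc_abs V).
Local Notation emb := (vc_emb V).
Local Notation E := (qexp F).
Implicit Types (x y z xi al be : V) (a b c u : {poly F}) (P : {poly {poly F}}).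
Implicit Types (ea eb ep : R).

(** In characteristic 2 the roots differ by b / a, and their distances to xi have product |G(xi)| /
    |a|. The last hypothesis makes this product smaller than |b / a|^2, so the distances are unequal
    and the larger one is |b / a|. *)
Lemma roots_distances a b c xi ea eb ep :
  (2%:R = 0 :> F) -> abs (emb a) = E ea -> abs (emb b) = E eb ->
  abs (peval (quad a b c) xi) = E ep -> ep + ea < 2 * eb ->
  exists al be, [/\ emb b = - (emb a * (al + be)), emb c = emb a * (al * be),
    abs (xi - al) = E (ep - eb) & abs (xi - be) = E (eb - ea)].
Proof.
move=> F2 ha hb hp lt_e.
have V2 := closure_char2 V F2.
have a0 : a != 0 by rewrite -(emb_eq0 V) -abs_gt0 ha qexp_gt0.
have [al [be [Eb Ec]]] := quad_roots V b c a0.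
wlog le_xy : al be Eb Ec / abs (xi - al) <= abs (xi - be).
  move=> H; have [le1|/ltW le1] := leP (abs (xi - al)) (abs (xi - be)).
    exact: H le1.
  by apply: H le1; rewrite ?[be + al]addrC // [be * al]mulrC.
have habe : abs ((xi - be) - (xi - al)) = E (eb - ea).
  have -> : (xi - be) - (xi - al) = - (emb b / emb a).
    have a0' : emb a != 0 by rewrite emb_eq0.
    rewrite (_ : _ - _ = al + be - 2%:R * be); last by ring.
    by rewrite V2 mul0r subr0 Eb; field.
  by rewrite absN vc_absM absV ha hb -qexpN -qexpD.
have hprod : abs (xi - al) * abs (xi - be) = E (ep - ea).
  rewrite -vc_absM; apply: (@mulfI _ (E ea)); first by rewrite gt_eqF ?qexp_gt0.
  rewrite -qexpD [ea + _]addrC subrK -ha -vc_absM -hp peval_quad Eb Ec; congr (abs _); ring.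
have be_d : abs (xi - be) = E (eb - ea).
  move: le_xy; rewrite le_eqVlt => /orP[/eqP exy|lxy]; last first.
    by rewrite -habe (@absD_dom _ _ _ (xi - be)) // absN.
  exfalso; have le1 : E (eb - ea) <= abs (xi - be).
    by rewrite -habe; apply: absB_le; rewrite // exy.
  have : E (eb - ea) * E (eb - ea) <= E (ep - ea).
    by rewrite -hprod exy ler_pM // qexp_ge0.
  by rewrite -qexpD ler_qexp; lra.
exists al, be; split=> //.
apply: (@mulIf _ (E (eb - ea))); first by rewrite gt_eqF ?qexp_gt0.
by rewrite -be_d hprod be_d -qexpD; congr E; ring.
Qed.

Definition badly_approximable xi := forall u t : {poly F}, u != 0 ->
  E (-1) <= abs (emb u * xi - emb t) * abs (emb u).

Lemma size_linear_eq0 z (r : {poly {poly F}}) :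
  (forall u t : {poly F}, emb u * z = emb t -> u = 0) ->
  (size r < 3)%N -> peval r z = 0 -> r = 0.
Proof.
move=> irr sr; rewrite (@pevalE _ _ _ _ _ 2) //.
rewrite big_ord_recl big_ord1 /= expr0 expr1 mulr1 => E0.
have r1 : r`_1 = 0.
  by apply: (irr _ (- r`_0)); rewrite rmorphN; apply/eqP; rewrite -addr_eq0 addrC E0.
have r0 : r`_0 = 0.
  by apply/eqP; rewrite -(emb_eq0 V) -E0 r1 rmorph0 mul0r addr0.
apply/polyP => -[|[|i]]; rewrite coef0 //.
by apply: nth_default; apply: leq_trans (_ : 2 <= i.+2)%N.
Qed.

(** A rational root would split the quadratic into linear factors over F_q[T]. Bad approximability
    bounds each factor at xi, times its leading coefficient, below by q^(-1), whence |a| |G(xi)| >=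
    q^(-2). *)
Lemma quad_irrational a b c xi ea ep z :
  unimodular a b c -> badly_approximable xi ->
  abs (emb a) = E ea -> abs (peval (quad a b c) xi) = E ep ->
  ep + ea < -2 -> peval (quad a b c) z = 0 ->
  forall y x : {poly F}, emb y * z = emb x -> y = 0.
Proof.
move=> uni bad ha hp lt_e Gz y x Eyz; apply: contrapT => /eqP y0.
wlog cop : y x y0 Eyz / coprimep y x.
  move=> H; have [g0 y1 x1] : [/\ gcdp y x != 0, gcdp y x %| y & gcdp y x %| x].
    by rewrite gcdp_eq0 (negPf y0) dvdp_gcdl dvdp_gcdr.
  apply: (H (y %/ gcdp y x) (x %/ gcdp y x)).
  - by rewrite dvdp_div_eq0.
  - apply: (@mulfI _ (emb (gcdp y x))); first by rewrite emb_eq0.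
    by rewrite mulrA -!rmorphM ![gcdp y x * _]mulrC !divpK.
  - by rewrite coprimep_div_gcd // y0.
pose L := y *: 'X - x%:P : {poly {poly F}}.
have cL i : L`_i = if i == 0%N then - x else if i == 1%N then y else 0.
  rewrite coefB coefZ coefX coefC; case: i => [|[|i]] /=;
  by rewrite ?mulr0 ?mulr1 ?subr0 ?sub0r.
have sL : size L = 2%N.
  apply/eqP; rewrite eqn_leq; apply/andP; split.
    by apply/leq_sizeP => -[|[|i]] // _; rewrite cL.
  rewrite ltnNge; apply/negP => /leq_sizeP /(_ 1%N (leqnn _)).
  by rewrite cL /=; apply/eqP.
have evL t : peval L t = emb y * t - emb x by rewrite pevalB pevalZ pevalX pevalC.
have primL : poly_primitive L.
  move=> g hg; apply/eqP; rewrite -dvdp1.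
  have := hg 0%N; have := hg 1%N; rewrite !cL /= dvdpNr => gy gx.
  have : g %| gcdp y x by rewrite dvdp_gcd gy.
  move=> /dvdp_trans; apply; rewrite dvdp1; exact: cop.
have [Q EQ] : exists Q, quad a b c = Q * L.
  apply: (primitive_root_dvd primL _ _ Gz); first by rewrite evL Eyz subrr.
  move=> r; rewrite sL ltnS => /size1_polyC ->; rewrite pevalC => /eqP.
  by rewrite emb_eq0 => /eqP ->.
have a0 : a != 0 by rewrite -(emb_eq0 V) -abs_gt0 ha qexp_gt0.
have Q0 : Q != 0.
  apply/eqP => Q0; have := size_quad b c a0.
  by rewrite EQ Q0 mul0r size_poly0.
have sQ : size Q = 2%N.
  have := size_quad b c a0; rewrite EQ size_mul ?sL // -?size_poly_gt0 ?sL //.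
  by rewrite addn2 => -[].
have Ea : a = Q`_1 * y.
  have := f_equal lead_coef EQ; rewrite lead_coef_quad // lead_coefM.
  by rewrite !lead_coefE sQ sL /= cL.
have q0 : Q`_1 != 0 by move: a0; rewrite Ea mulf_eq0 negb_or => /andP[].
have b1 := bad _ x y0; have b2 := bad _ (- Q`_0) q0.
have : E (-1) * E (-1) <= E (ep + ea).
  rewrite (le_trans (ler_pM (qexp_ge0 _ _) (qexp_ge0 _ _) b1 b2)) //.
  rewrite qexpD -hp -ha EQ pevalM evL Ea rmorphM !vc_absM.
  rewrite (pevalE _ (_ : size Q <= 2)%N) ?sQ // big_ord_recl big_ord1 /=.
  rewrite expr0 expr1 mulr1 rmorphN opprK [emb Q`_0 + _]addrC le_eqVlt.
  by apply/orP; left; apply/eqP; ring.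
by rewrite -qexpD ler_qexp; lra.
Qed.

Lemma quad_root_dvd a b c z :
  unimodular a b c -> a != 0 -> peval (quad a b c) z = 0 ->
  (forall y x : {poly F}, emb y * z = emb x -> y = 0) ->
  forall P, peval P z = 0 -> exists Q, P = Q * quad a b c.
Proof.
move=> uni a0 Gz irr P Pz.
apply: (primitive_root_dvd (unimodular_primitive uni) Gz _ Pz) => r.
by rewrite size_quad //; exact: size_linear_eq0.
Qed.

End QuadraticRoots.

(** * Suprema of exponents and finiteness of sets of bounded height *)

Section Suprema.
Variable R : realType.

Lemma le_sup_EFin (S : set R) (w : R) :
  (forall w', w' < w -> S w') -> (w%:E <= ereal_sup [set x%:E | x in S])%E.
Proof.
move=> h; rewrite leNgt; apply/negP => lt.
have [w' /andP[l1 l2]] : exists w' : R, (ereal_sup [set x%:E | x in S] <= w'%:E < w%:E)%E.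
  move: lt; case: (ereal_sup _) => [x||] //; rewrite ?lte_fin.
    by move=> xw; exists x; rewrite lexx lte_fin.
  by move=> _; exists (w - 1); rewrite leNye lte_fin ltrBlDr ltrDl ltr01.
rewrite lte_fin in l2.
have lt2 : (w' + w) / 2 < w by lra.
have /ereal_sup_ubound le1 : (EFin @` S)%classic ((w' + w) / 2)%:E.
  by exists ((w' + w) / 2) => //; exact: h.
have := le_trans le1 l1; rewrite lee_fin; lra.
Qed.

Lemma ge_sup_EFin (S : set R) (w : R) :
  (forall w', S w' -> w' <= w) -> (ereal_sup [set x%:E | x in S] <= w%:E)%E.
Proof.
move=> h; apply: ge_ereal_sup => _ [x Sx <-]; rewrite lee_fin; exact: h.
Qed.

Lemma infinite_unbounded (T : eqType) (f : T -> R) (A : set T) :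
  (forall M, exists2 x, A x & M < f x) -> infinite_set A.
Proof.
move=> h /finite_seqP [s As].
have [M hM] : exists M, forall x, x \in s -> f x <= M.
  elim: s {As} => [|y s [M hM]]; first by exists 0.
  exists (Num.max (f y) M) => x; rewrite inE le_max => /orP[/eqP ->|/hM ->].
    by rewrite lexx.
  by rewrite orbT.
have [x] := h M; rewrite As /= => /hM le1; by rewrite ltNge le1.
Qed.

End Suprema.

Section FiniteSets.
Variables (F : finFieldType) (R : realType) (V : valued_closure F R).

Lemma finite_bounded_polys n (M : R) :
  finite_set [set P : {poly {poly F}} | (size P <= n)%N /\ ht R P <= M].
Proof.
pose N := (Num.truncn M).+2.
pose f (g : {ffun 'I_n * 'I_N -> F}) : {poly {poly F}} :=
  \sum_(i < n) (\sum_(j < N) g (i, j) *: 'X^j) *: 'X^i.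
apply: (@sub_finite_set _ _ (f @` setT)%classic); last first.
  exact/finite_image/finite_finset.
move=> P [sP hP]; pose g := [ffun ij : 'I_n * 'I_N => P`_(ij.1)`_(ij.2)].
exists g => //.
have sc (i : nat) : (size (P`_i)%R <= N)%N.
  apply: leq_trans (max_size_coefXY _ _) _.
  have : ((sizeY P).-1 <= Num.truncn M)%N.
    rewrite truncn_ge_nat // (le_trans _ hP) //; exact: ht_ge0.
  by rewrite /N; lia.
rewrite /f -[RHS]coefK (poly_def (size P)) (big_ord_widen n (fun i => P`_i *: 'X^i)) //.
rewrite [RHS]big_mkcond; apply: eq_bigr => i _ /=.
have -> : \sum_(j < N) g (i, j) *: 'X^j = P`_i.
  rewrite -[RHS]coefK (poly_def (size P`_i)).
  rewrite (big_ord_widen N (fun j => P`_i`_j *: 'X^j)) // [RHS]big_mkcond.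
  apply: eq_bigr => j _; rewrite ffunE /=.
  by case: ltnP => // /(nth_default 0) ->; rewrite scale0r.
by case: ltnP => // /(nth_default 0) ->; rewrite scale0r.
Qed.

Lemma finite_roots (P : {poly {poly F}}) : P != 0 ->
  finite_set [set x : V | peval P x = 0].
Proof.
move=> P0.
have mP0 : map_poly (vc_emb V) P != 0.
  by rewrite -size_poly_gt0 size_map_inj_poly ?rmorph0 ?size_poly_gt0 //; exact: emb_inj.
have [rs Ers] := closed_field_poly_normal (map_poly (vc_emb V) P).
apply: (@sub_finite_set _ _ [set` rs]); last exact: finite_seq.
move=> x /= Px; rewrite -root_prod_XsubC /root.
move: Px; rewrite /peval Ers hornerZ => /eqP; rewrite mulf_eq0 => /orP[|//].
by rewrite lead_coef_eq0 (negPf mP0).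
Qed.

End FiniteSets.

(** * Exponents from a sequence of quadratic approximations *)

(** For k minimal, the preceding height is still below the threshold, and the growth bound controls
    the overshoot; the term with [h 0] covers k = 0. *)
Lemma first_exceeding (R : realType) (h : nat -> R) (r K D t : R) :
  0 <= r -> 0 < D -> 0 <= t -> 0 <= K -> (forall k, 0 <= h k) ->
  (forall M, exists k, M < h k) -> (forall k, h k.+1 <= r * h k + K) ->
  exists k, t < D * h k /\ D * h k <= r * t + D * (h 0%N + K).
Proof.
move=> r0 D0 t0 K0 h0 unb gr.
have ex : exists k, t < D * h k.
  by have [k hk] := unb (t / D); exists k; rewrite mulrC -ltr_pdivrMr.
case: (ex_minnP ex) => k hk mink; exists k; split=> //.
case: k hk mink => [|k] hk mink.
  have := mulr_ge0 r0 t0; have := mulr_ge0 (ltW D0) K0; rewrite mulrDr; lra.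
have le1 : D * h k <= t.
  by rewrite leNgt; apply/negP => /mink; rewrite ltnn.
have := ler_wpM2l r0 le1; have := ler_wpM2l (ltW D0) (gr k).
have := mulr_ge0 (ltW D0) (h0 0%N); rewrite !mulrDr mulrCA; lra.
Qed.

(** Here H and g are the logarithmic heights of P and G_k, x is the degree bound, and the last
    premise is the logarithm of 1 <= |a|^x |P(al)| |P(be)|. Each maximum bounds a value of P at a
    root either by |P(xi)| or by the distance from xi to that root. If both come from distances, g
    is too large; if only the one at be does, the upper bound on D g contradicts 2r(x - v) <= D(w -
    1). *)
Lemma exponent_contradiction (R : realType) (w v r x C K C3 H g : R)
    (D := 1 + w + v - x) :
  0 <= H -> 0 <= v -> v <= 1 -> 2 <= x -> 0 <= r -> 0 < D ->
  2 * r * (x - v) <= D * (w - 1) -> 0 <= C3 -> 0 <= K ->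
  D * (C - K) = x * C3 + D -> 2 * H + 2 * K < D * g -> D * g <= 2 * r * H + C3 ->
  0 <= x * g + (Num.max (- w * H - C) (- (1 + w) * g + H + K) +
                Num.max (- w * H - C) (- v * g + H + K)) -> False.
Proof.
move=> H0 v0 v1 x2 r0 D0 Dw C3_0 K0 EC hk1 hk2.
have nv0 : 0 <= x - v by lra.
have h1 := ler_wpM2l nv0 hk2.
have h2 := ler_wpM2l v0 hk2.
have Dw' := ler_wpM2r H0 Dw.
have vC3 : v * C3 <= (x - v) * C3 by rewrite ler_wpM2r //; lra.
have vrH : v * (2 * r * H) <= (x - v) * (2 * r * H).
  by rewrite ler_wpM2r ?mulr_ge0 //; lra.
have vC0 : 0 <= v * C3 by rewrite mulr_ge0.
have DH : 0 <= D * H by rewrite mulr_ge0 // ltW.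
have D_K1 : 0 <= D * K by rewrite mulr_ge0 // ltW.
have [leB|/ltW leB] := leP (- w * H - C) (- v * g + H + K).
  have [leA|/ltW leA] := leP (- w * H - C) (- (1 + w) * g + H + K).
    by move: hk1; rewrite /D; clear; lra.
  move=> h3; have {}h3 : (w - 1) * H + (C - K) <= (x - v) * g.
    by move: h3; clear; lra.
  have := ler_wpM2l (ltW D0) h3; move: h1 EC Dw' vC0 D0; clearbody D; clear.
  have -> : D * ((w - 1) * H + (C - K)) = D * (w - 1) * H + D * (C - K) by ring.
  have -> : D * ((x - v) * g) = (x - v) * (D * g) by ring.
  have -> : (x - v) * (2 * r * H + C3) = 2 * r * (x - v) * H + x * C3 - v * C3.
    by ring.
  by move=> h1 -> Dw' vC0 D0; lra.
(* The value at the far root cannot be governed by |P(xi)|: this would make v g too large, because v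
   <= 1 <= x - v. *)
move=> _.
have h3 : (w + 1) * H + (C + K) <= v * g by move: leB; clear; lra.
have := ler_wpM2l (ltW D0) h3; move: h2 EC Dw' vC0 D0 vrH vC3 DH D_K1; clearbody D; clear.
have -> : D * ((w + 1) * H + (C + K)) =
  D * (w - 1) * H + 2 * (D * H) + D * (C - K) + 2 * (D * K) by ring.
have -> : D * (v * g) = v * (D * g) by ring.
have -> : v * (2 * r * H + C3) = v * (2 * r * H) + v * C3 by ring.
have -> : (x - v) * (2 * r * H) = 2 * r * (x - v) * H by ring.
have -> : (x - v) * C3 = x * C3 - v * C3 by ring.
by move=> h2 -> Dw' vC0 D0; lra.
Qed.

Section Exponents.
Variables (F : finFieldType) (R : realType) (V : valued_closure F R).
Local Notation abs := (vc_abs V).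
Local Notation emb := (vc_emb V).
Local Notation E := (qexp F).
Local Notation ht := (ht R).
Variables (xi : V) (a b c : nat -> {poly F}) (al be : nat -> V) (w v r K : R).
Local Notation G k := (quad (a k) (b k) (c k)).
Local Notation h k := (ht (G k)).
Implicit Types (P : {poly {poly F}}) (z : V).
Hypotheses (K0 : 0 <= K) (r0 : 0 <= r) (w0 : 0 < w) (v0 : 0 <= v) (v1 : v <= 1).
Hypothesis xi_le : abs xi <= E K.
Hypothesis a0 : forall k, a k != 0.
Hypothesis uni : forall k, unimodular (a k) (b k) (c k).
Hypothesis hb : forall k, emb (b k) = - (emb (a k) * (al k + be k)).
Hypothesis hc : forall k, emb (c k) = emb (a k) * (al k * be k).
Hypothesis dvd : forall k P, peval P (al k) = 0 \/ peval P (be k) = 0 ->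
  exists Q, P = Q * G k.
Hypothesis al_le : forall k, abs (xi - al k) <= E (- (1 + w) * h k + K).
Hypothesis al_ge : forall k, E (- (1 + w) * h k - K) <= abs (xi - al k).
Hypothesis be_le : forall k, abs (xi - be k) <= E (- v * h k + K).
Hypothesis be_ge : forall k, E (- v * h k - K) <= abs (xi - be k).
Hypothesis G_le : forall k, abs (peval (G k) xi) <= E (- (w + v) * h k + K).
Hypothesis G_ge : forall k, E (- (w + v) * h k - K) <= abs (peval (G k) xi).
Hypothesis grow : forall k, h k.+1 <= r * h k + K.
Hypothesis unb : forall M, exists k, M < h k.

Lemma form_neq0 k : G k != 0.
Proof. by rewrite -size_poly_gt0 size_quad. Qed.

Lemma form_root k z : (peval (G k) z == 0) = (z == al k) || (z == be k).
Proof.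
have -> : peval (G k) z = emb (a k) * ((z - al k) * (z - be k)).
  rewrite peval_quad hb hc; ring.
by rewrite !mulf_eq0 emb_eq0 (negPf (a0 k)) !subr_eq0.
Qed.

Lemma powR_polyH P x : P != 0 -> powR (polyH R P) x = E (x * ht P).
Proof. by move=> P0; rewrite polyHE // qexpM mulrC. Qed.

(** One of the factors vanishes at [al k], so by [dvd] it is a multiple of G_k and the other factor
    is a unit. *)
Lemma form_irreducible k A B : G k = A * B ->
  A \is a GRing.unit \/ B \is a GRing.unit.
Proof.
move=> EG.
wlog Az : A B EG / peval A (al k) = 0.
  move=> H; have : peval (G k) (al k) == 0 by rewrite form_root eqxx.
  rewrite EG pevalM mulf_eq0 => /orP[] /eqP z; first exact: (H A B).
  by case: (H B A) => //; [rewrite mulrC|right|left].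
right; have [Q EQ] := dvd (or_introl Az).
have : G k * (Q * B) = G k * 1.
  by rewrite mulr1 {2}EG EQ; ring.
move/(mulfI (form_neq0 k)) => QB1.
by apply/unitrPr; exists Q; rewrite mulrC.
Qed.

Lemma form_minpoly k z : peval (G k) z = 0 ->
  exists2 P, is_minpoly z P & (size P = 3%N) /\ ht P = h k.
Proof.
(* Dividing by a constant of F makes the leading coefficient monic in T without changing height or
   irreducibility. *)
move=> Gz; pose e : F := (lead_coef (a k))^-1.
have lc0 : lead_coef (a k) != 0 by rewrite lead_coef_eq0.
have e0 : e != 0 by rewrite invr_eq0.
have eP0 : e%:P != 0 :> {poly F} by rewrite polyC_eq0.
have ePP0 : (e%:P)%:P != 0 :> {poly {poly F}} by rewrite polyC_eq0.
have unit_e : (e%:P)%:P \is a @GRing.unit {poly {poly F}}.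
  by apply/unitrPr; exists (lead_coef (a k))%:P%:P; rewrite -!polyCM mulVf.
have PE : e%:P *: G k = (e%:P)%:P * G k by rewrite mul_polyC.
exists (e%:P *: G k); last first.
  split; first by rewrite size_scale // size_quad.
  rewrite PE htM ?form_neq0 // /ht -[X in _ = X]add0r; congr (_ + _).
  have : sizeY (e%:P)%:P = 1%N.
    rewrite /sizeY size_polyC eP0 /= big_ord_recl big_ord0 maxn0 coefC /=.
    by rewrite size_polyC e0.
  by move=> ->.
split.
- by rewrite size_scale // size_quad.
- split; first by rewrite PE mulf_neq0 // form_neq0.
  split.
    rewrite poly_unitE size_scale // size_quad //.
  move=> A B EAB.
  have : G k = ((e%:P)%:P^-1 * A) * B.
    by rewrite -mulrA -EAB PE mulrA mulVr // mul1r.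
  case/form_irreducible => [|]; last by right.
  by rewrite unitrMr ?unitrV // => uA; left.
- move=> d hd; apply: (unimodular_primitive (uni k)) => i.
  have := hd i; rewrite coefZ => h1.
  have -> : (G k)`_i = (lead_coef (a k))%:P * (e%:P * (G k)`_i).
    by rewrite mulrA -polyCM mulfV // mul1r.
  by rewrite dvdp_mull.
- rewrite -mul_polyC lead_coefM lead_coefC lead_coef_quad // monicE lead_coefM.
  by rewrite lead_coefC mulVf.
- by rewrite pevalZ Gz mulr0.
Qed.

Lemma wn_ge n : (2 <= n)%N -> ((w + v)%:E <= wn n xi)%E.
Proof.
move=> n2; apply: le_sup_EFin => w' lt_w /=.
apply: (@infinite_unbounded _ _ ht) => M.
have [k hk] := unb (Num.max M (K / (w + v - w'))).
move: hk; rewrite gt_max => /andP[hM hK].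
exists (G k) => //; split.
- by rewrite size_quad // ltnS.
- by apply: lt_le_trans (G_ge k); rewrite qexp_gt0.
- rewrite powR_polyH ?form_neq0 //; apply: le_trans (G_le k) _; rewrite ler_qexp.
  move: hK; rewrite ltr_pdivrMr ?subr_gt0 //; lra.
Qed.

Lemma wnstar_ge n : (2 <= n)%N -> (w%:E <= wnstar n xi)%E.
Proof.
(* That the [al k] form an infinite set is seen from the unboundedness of the inverse distance to
   xi. *)
move=> n2; apply: le_sup_EFin => w' lt_w /=.
apply: (@infinite_unbounded _ _ (fun z => (abs (xi - z))^-1)) => M.
have M1 : 0 < Num.max M 1 by rewrite lt_max ltr01 orbT.
have [e eM] := qexpP F M1.
have [k hk] := unb (Num.max (e + K) (K / (w - w'))).
move: hk; rewrite gt_max => /andP[hM hK].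
have h0 : 0 <= h k := ht_ge0 _ _.
have wh : 0 <= w * h k by rewrite mulr_ge0 // ltW.
have pos : 0 < abs (xi - al k) by apply: lt_le_trans (al_ge k); rewrite qexp_gt0.
exists (al k); last first.
  apply: (@le_lt_trans _ _ (Num.max M 1)); first by rewrite le_max lexx.
  rewrite eM -[E e]invrK ltf_pV2 ?posrE ?invr_gt0 ?qexp_gt0 //.
  apply: le_lt_trans (al_le k) _; rewrite -qexpN ltr_qexp.
  lra.
have [|P mP [sP hP]] := @form_minpoly k (al k); first by apply/eqP; rewrite form_root eqxx.
exists P; split=> //; first by rewrite sP ltnS.
have P0 : P != 0 by rewrite -size_poly_gt0 sP.
rewrite powR_polyH //; apply: le_trans (al_le k) _; rewrite ler_qexp hP.
move: hK; rewrite ltr_pdivrMr ?subr_gt0 //; lra.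
Qed.

Section UpperBounds.
Variable n : nat.
Hypothesis n2 : (2 <= n)%N.
Local Notation D := (1 + w + v - n%:R).
Hypothesis D0 : 0 < D.
Hypothesis Dw : 2 * r * (n%:R - v) <= D * (w - 1).

Lemma abs_near_le z t : 0 <= t -> abs (xi - z) <= E (- t + K) -> abs z <= E K.
Proof.
move=> t0 hz; have -> : z = xi - (xi - z) by rewrite subKr.
by apply: absB_le => //; apply: le_trans hz _; rewrite ler_qexp; lra.
Qed.

Lemma abs_al_le k : abs (al k) <= E K.
Proof.
apply: (@abs_near_le _ ((1 + w) * h k)); last by rewrite -mulNr al_le.
by rewrite mulr_ge0 ?ht_ge0 // addr_ge0 // ltW.
Qed.

Lemma abs_be_le k : abs (be k) <= E K.
Proof.
apply: (@abs_near_le _ (v * h k)); last by rewrite -mulNr be_le.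
by rewrite mulr_ge0 ?ht_ge0.
Qed.

(** P is compared with the first G_k whose logarithmic height passes (2H + 2 K1) / D, where H =
    [ht P]; by [grow] that height is at most 2rH / D up to a constant. If |P(xi)| were too small,
    the nonzero resultant of P and G_k would have absolute value below 1. *)
Lemma coprime_lower_bound : exists2 C, 0 <= C & forall P, (size P <= n.+1)%N ->
  (forall k, peval P (al k) != 0 /\ peval P (be k) != 0) ->
  E (- w * ht P - C) <= abs (peval P xi).
Proof.
pose K1 := K + n%:R * K.
have K1_0 : 0 <= K1 by rewrite addr_ge0 // mulr_ge0.
(* The constant that [first_exceeding] yields for the threshold 2H + 2 K1. *)
pose C3 := 2 * r * K1 + D * (h 0%N + K).
have C3_0 : 0 <= C3.
  apply: addr_ge0; apply: mulr_ge0 => //; [exact: mulr_ge0|exact: ltW|].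
  by apply: addr_ge0 => //; exact: ht_ge0.
have nR2 : 2 <= n%:R :> R by rewrite (ler_nat R 2).
have C_0 : 0 <= n%:R * C3 / D.
  by apply: divr_ge0; [exact: mulr_ge0|exact: ltW].
(* Chosen to make D (C - K1) = n C3 + D; the summand 1 provides the strictness of the final
   contradiction. *)
exists (K1 + n%:R * C3 / D + 1) => [|P sP nz].
  by apply: addr_ge0 => //; exact: addr_ge0.
rewrite leNgt; apply/negP => lt_xi.
set C := K1 + _ + 1 in lt_xi.
have EC : D * (C - K1) = n%:R * C3 + D.
  by rewrite /C; field; rewrite gt_eqF.
pose H := ht P; have H0 : 0 <= H := ht_ge0 _ _.
have [k [hk1 hk2]] : exists k, 2 * H + 2 * K1 < D * h k /\
    D * h k <= r * (2 * H + 2 * K1) + D * (h 0%N + K).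
  apply: (first_exceeding (h := fun k => h k)) => //.
  by rewrite addr_ge0 ?mulr_ge0.
have {}hk2 : D * h k <= 2 * r * H + C3 by rewrite /C3; lra.
pose g := h k; have g0 : 0 <= g := ht_ge0 _ _.
rewrite -/g in hk1 hk2.
have ev_le z e : abs z <= E K -> abs (xi - z) <= E (e + K) ->
    abs (peval P z) <= E (Num.max (- w * H - C) (e + H + K1)).
  move=> hz hxz; rewrite -(subrK (peval P xi) (peval P z)); apply: absD_le.
    rewrite abs_subC; apply: le_trans (peval_diff_le sP K0 xi_le hz hxz) _.
    by rewrite -qexpD ler_qexp le_max /H /K1; apply/orP; right; lra.
  by rewrite (le_trans (ltW lt_xi)) // ler_qexp le_max lexx.
have [nal nbe] := nz k.
have hA := ev_le _ _ (abs_al_le k) (al_le k).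
have hB := ev_le _ _ (abs_be_le k) (be_le k).
have ha : abs (emb (a k)) <= E g.
  by apply: abs_emb_le; have := pdeg_le_ht R (G k) 2; rewrite coef_quad.
have nz_prod : emb (a k) ^+ n * (peval P (al k) * peval P (be k)) != 0.
  by rewrite !mulf_neq0 // expf_neq0 // emb_eq0.
have := integral_ge1 (integral_norm (hb k) (hc k) sP) nz_prod.
rewrite -(qexp0 F).
move=> /le_trans /(_ (absM_le (absX_le n ha) (absM_le hA hB))).
rewrite ler_qexp -/g.
by move=> le0; exact: (exponent_contradiction H0 v0 v1 nR2 r0 D0 Dw C3_0 K1_0 EC hk1 hk2 le0).
Qed.

(** Induction on the degree: if P shares a root with some G_k, it is divided by G_k. Heights are
    additive and G_k itself satisfies the bound, so only the constant deteriorates, by at most C + K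
    per step. *)
Lemma value_lower_bound : exists2 C, 0 <= C & forall P, (size P <= n.+1)%N ->
  peval P xi != 0 -> E (- (w + v) * ht P - C) <= abs (peval P xi).
Proof.
have [C C0 hC] := coprime_lower_bound.
suff H : forall m P, (size P <= m)%N -> (m <= n.+1)%N -> peval P xi != 0 ->
    E (- (w + v) * ht P - (C + K) * m%:R) <= abs (peval P xi).
  exists ((C + K) * n.+1%:R); first by rewrite mulr_ge0 // addr_ge0.
  by move=> P sP Pn; apply: H.
elim=> [|m IH] P sP mn Px.
  by move: Px sP; rewrite leqn0 size_poly_eq0 => + /eqP P0; rewrite P0 /peval rmorph0 horner0 eqxx.
have CKm : 0 <= (C + K) * m%:R by rewrite mulr_ge0 // addr_ge0.
have vH : 0 <= v * ht P by rewrite mulr_ge0 // ht_ge0.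
have [nz|] := pselect (forall k, peval P (al k) != 0 /\ peval P (be k) != 0).
  apply: le_trans (hC P (leq_trans sP mn) nz); rewrite ler_qexp.
  rewrite -natr1 mulrDr mulr1; have := K0; lra.
move=> nnz; have [k zk] : exists k, peval P (al k) = 0 \/ peval P (be k) = 0.
  apply: contrapT => nex; apply: nnz => k; split; apply/eqP => e; apply: nex; exists k;
  by [left|right].
have [Q EQ] := dvd zk.
move: Px; rewrite EQ pevalM mulf_eq0 negb_or => /andP[Qx Gx].
have Q0 : Q != 0 by apply: contraNneq Qx => ->; rewrite /peval rmorph0 horner0.
have sQ : (size Q <= m)%N.
  move: sP; rewrite EQ size_mul ?form_neq0 // size_quad // addn3 /=.
  exact: ltnW.
rewrite htM ?form_neq0 // vc_absM.
apply: le_trans (ler_pM _ _ (IH Q sQ (ltnW mn) Qx) (G_ge k)); rewrite ?qexp_ge0 //.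
by rewrite -qexpD ler_qexp -natr1; have := C0; lra.
Qed.

(** If P has no root in common with any G_k, passing from |P(xi)| = |P(xi) - P(z)| to |xi - z| loses
    one more factor H(P), which is the 1 in 1 + w. Otherwise the irreducible P is a unit multiple of
    some G_k, and z is one of its two roots. *)
Lemma distance_lower_bound : exists2 C, 0 <= C & forall P z, (size P <= n.+1)%N ->
  is_minpoly z P -> xi != z -> E (- (1 + w) * ht P - C) <= abs (xi - z).
Proof.
have [C C0 hC] := coprime_lower_bound.
exists (C + K + n%:R * K) => [|P z sP [sP1 [P0 [_ irr]] _ _ Pz] nz].
  by rewrite !addr_ge0 // mulr_ge0.
have nK : 0 <= n%:R * K by rewrite mulr_ge0.
have [K0' w0' v1'] := And3 K0 w0 v1.
have hP0 : 0 <= ht P := ht_ge0 _ _.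
have whP : 0 <= w * ht P by rewrite mulr_ge0 // ltW.
have [lt1|le1] := ltP 1 (abs (xi - z)).
  apply: le_trans (ltW lt1); by rewrite qexp_le1; lra.
have [nnz|] := pselect (forall k, peval P (al k) != 0 /\ peval P (be k) != 0).
  have z_le : abs z <= E K.
    rewrite -(subKr xi z); apply: absB_le => //.
    by apply: le_trans le1 _; rewrite -(qexp0 F) ler_qexp.
  have := peval_diff_le sP K0 xi_le z_le (lexx _).
  rewrite Pz subr0 => /(le_trans (hC P sP nnz)).
  rewrite -(@ler_pM2r _ (E (- (ht P + n%:R * K)))) ?qexp_gt0 //.
  rewrite -mulrA -!qexpD subrr qexp0 mulr1.
  by apply: le_trans; rewrite ler_qexp; lra.
move=> nnz; have [k zk] : exists k, peval P (al k) = 0 \/ peval P (be k) = 0.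
  apply: contrapT => nex; apply: nnz => k; split; apply/eqP => e; apply: nex; exists k;
  by [left|right].
have [Q EQ] := dvd zk.
have Q0 : Q != 0 by apply: contraNneq P0 => Q0; rewrite EQ Q0 mul0r.
have [uQ|uG] := irr _ _ EQ; last first.
  by move: uG; rewrite poly_unitE size_quad.
have [Q' QQ'] : exists Q', Q * Q' = 1 by exists Q^-1; rewrite divrr.
have htQ : ht Q = 0.
  have Q'0 : Q' != 0.
    by apply: contra_eq_neq QQ' => ->; rewrite mulr0 eq_sym oner_eq0.
  have := htM R Q0 Q'0; rewrite QQ' ht1.
  have := ht_ge0 R Q; have := ht_ge0 R Q'; lra.
have hPk : ht P = h k by rewrite EQ htM ?form_neq0 // htQ add0r.
have Qz : peval Q z != 0.
  have := f_equal (fun p => peval p z) QQ'.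
  rewrite /= pevalM -[1 in RHS]polyC1 pevalC rmorph1 => e1.
  by apply: contra_eq_neq e1 => ->; rewrite mul0r eq_sym oner_eq0.
have gz : peval (G k) z == 0.
  by move/eqP: Pz; rewrite EQ pevalM mulf_eq0 (negPf Qz).
move: gz; rewrite form_root => /orP[] /eqP ->.
  by apply: le_trans (al_ge k); rewrite ler_qexp hPk; lra.
apply: le_trans (be_ge k); rewrite ler_qexp hPk.
have : 0 <= (1 + w - v) * h k by rewrite mulr_ge0 ?ht_ge0 //; lra.
rewrite mulrBl !mulNr; lra.
Qed.

Lemma wn_le : (wn n xi <= (w + v)%:E)%E.
Proof.
have [C C0 hC] := value_lower_bound.
apply: ge_sup_EFin => w' /= inf; rewrite leNgt; apply/negP => lt_w; apply: inf.
apply: (@sub_finite_set _ _ _ _ (@finite_bounded_polys F R n.+1 (C / (w' - (w + v))))).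
move=> P /= [sP Px le1]; split=> //.
have Px0 : peval P xi != 0 by rewrite -abs_gt0.
have P0 : P != 0 by apply: contraNneq Px0 => ->; rewrite /peval rmorph0 horner0.
have := le_trans (hC P sP Px0) le1.
rewrite powR_polyH // ler_qexp ler_pdivlMr ?subr_gt0 // mulrBr; lra.
Qed.

(** A bounded height leaves finitely many minimal polynomials, each with finitely many roots. *)
Lemma wnstar_le : (wnstar n xi <= w%:E)%E.
Proof.
have [C C0 hC] := distance_lower_bound.
apply: ge_sup_EFin => w' /= inf; rewrite leNgt; apply/negP => lt_w; apply: inf.
pose B := [set P : {poly {poly F}} |
  P != 0 /\ ((size P <= n.+1)%N /\ ht P <= C / (w' - w))]%classic.
have finB : finite_set B.
  apply: (@sub_finite_set _ _ _ _ (@finite_bounded_polys F R n.+1 (C / (w' - w)))).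
  by move=> P [].
have := bigcup_finite finB (fun P (hP : B P) => finite_roots V (proj1 hP)).
apply: sub_finite_set => z /= [P [mP sP zx le1]].
have [_ [P0 _] _ _ Pz] := mP.
exists P => //; split=> //; split=> //.
have nz : xi != z by rewrite -subr_eq0 -abs_gt0.
have := le_trans (hC P z sP mP nz) le1.
rewrite powR_polyH // ler_qexp ler_pdivlMr ?subr_gt0 // mulrBr; lra.
Qed.

End UpperBounds.
End Exponents.

(** * Complete quotients and chains of quadratic forms *)

Section FromForms.
Variables (F : finFieldType) (R : realType) (V : valued_closure F R).
Local Notation abs := (vc_abs V).
Local Notation emb := (vc_emb V).
Local Notation E := (qexp F).
Local Notation ht := (ht R).

(** The near and far roots have distance exponents ep - eb, about -(1 + w)h, and eb - ea, about -vh.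
    Differences double the errors, so [K] becomes [2 * K] in the application of the previous
    section. *)
Lemma exponents_of_forms (xi : V) (a b c : nat -> {poly F}) (w v r K : R)
    (ea eb ep : nat -> R) (h := fun k => ht (quad (a k) (b k) (c k))) :
  2%:R = 0 :> F -> 0 <= K -> 0 <= r -> 0 < w -> 0 <= v -> v <= 1 -> 1 < w + v ->
  abs xi <= E K -> badly_approximable xi ->
  (forall k, unimodular (a k) (b k) (c k)) ->
  (forall k, abs (emb (a k)) = E (ea k)) ->
  (forall k, abs (emb (b k)) = E (eb k)) ->
  (forall k, abs (peval (quad (a k) (b k) (c k)) xi) = E (ep k)) ->
  (forall k, h k - K <= ea k <= h k + K) ->
  (forall k, (1 - v) * h k - K <= eb k <= (1 - v) * h k + K) ->
  (forall k, - (w + v) * h k - K <= ep k <= - (w + v) * h k + K) ->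
  (forall k, h k.+1 <= r * h k + K) ->
  (forall M, exists k0, forall k, (k0 <= k)%N -> M < h k) ->
  forall n, (2 <= n)%N ->
  ((w%:E <= wnstar n xi)%E /\ ((w + v)%:E <= wn n xi)%E) /\
  (0 < 1 + w + v - n%:R ->
   2 * r * (n%:R - v) <= (1 + w + v - n%:R) * (w - 1) ->
   wnstar n xi = w%:E /\ wn n xi = (w + v)%:E).
Proof.
move=> F2 K0 r0 w0 v0 v1 wv1 xiK bad uni ha hb hp ea_h eb_h ep_h grow unb n n2.
(* Past the first bound |G(xi)| |a| < |b|^2, which separates the roots; past the second |G(xi)| |a|
   < q^(-2), which excludes rational roots. Earlier forms are dropped, hence the shift by [k0]. *)
have [k0 hk0] := unb (Num.max (4 * K / (1 + w - v)) ((2 + 2 * K) / (w + v - 1))).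
have lt_roots k : (k0 <= k)%N -> ep k + ea k < 2 * eb k.
  move=> /hk0; rewrite gt_max => /andP[]; rewrite ltr_pdivrMr; last by lra.
  move=> lt1 _; move: (ea_h k) (eb_h k) (ep_h k) => /andP[_ +] /andP[+ _] /andP[_ +].
  by move: lt1; rewrite mulrC; lra.
have lt_irr k : (k0 <= k)%N -> ep k + ea k < -2.
  move=> /hk0; rewrite gt_max => /andP[_]; rewrite ltr_pdivrMr; last by lra.
  move=> lt1; move: (ea_h k) (ep_h k) => /andP[_ +] /andP[_ +].
  by move: lt1; rewrite mulrC; lra.
have a0 k : a k != 0 by rewrite -(emb_eq0 V) -abs_gt0 ha qexp_gt0.
have /choice [al /choice [be albe]] : forall k, exists al be,
    [/\ emb (b (k0 + k)%N) = - (emb (a (k0 + k)%N) * (al + be)),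
    emb (c (k0 + k)%N) = emb (a (k0 + k)%N) * (al * be),
    abs (xi - al) = E (ep (k0 + k)%N - eb (k0 + k)%N)
    & abs (xi - be) = E (eb (k0 + k)%N - ea (k0 + k)%N)].
  move=> k; apply: roots_distances (ha _) (hb _) (hp _) _ => //.
  by apply: lt_roots; rewrite leq_addr.
pose a' k := a (k0 + k)%N; pose b' k := b (k0 + k)%N; pose c' k := c (k0 + k)%N.
have K2 : 0 <= 2 * K by lra.
have xiK2 : abs xi <= E (2 * K) by apply: le_trans xiK _; rewrite ler_qexp; lra.
have a0' k : a' k != 0 by exact: a0.
have uni' k : unimodular (a' k) (b' k) (c' k) by exact: uni.
have Eb' k : emb (b' k) = - (emb (a' k) * (al k + be k)) by have [] := albe k.
have Ec' k : emb (c' k) = emb (a' k) * (al k * be k) by have [] := albe k.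
have root k z : z = al k \/ z = be k -> peval (quad (a' k) (b' k) (c' k)) z = 0.
  by move=> [] ->; rewrite peval_quad Eb' Ec'; ring.
have dvd' k (P : {poly {poly F}}) : peval P (al k) = 0 \/ peval P (be k) = 0 ->
    exists Q, P = Q * quad (a' k) (b' k) (c' k).
  move=> zP; have [z zr Pz] : exists2 z, z = al k \/ z = be k & peval P z = 0.
    by case: zP => ?; [exists (al k)|exists (be k)] => //; [left|right].
  apply: (quad_root_dvd (uni' k) (a0' k) (root k z zr) _ Pz).
  apply: (quad_irrational (uni' k) bad (ha _) (hp _)) (root k z zr).
  by apply: lt_irr; rewrite leq_addr.
have hE k : ht (quad (a' k) (b' k) (c' k)) = h (k0 + k)%N by [].
have al_le k : abs (xi - al k) <= E (- (1 + w) * ht (quad (a' k) (b' k) (c' k)) + 2 * K).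
  have [_ _ -> _] := albe k; rewrite hE ler_qexp.
  by move: (eb_h (k0 + k)%N) (ep_h (k0 + k)%N) => /andP[+ _] /andP[_ +]; lra.
have al_ge k : E (- (1 + w) * ht (quad (a' k) (b' k) (c' k)) - 2 * K) <= abs (xi - al k).
  have [_ _ -> _] := albe k; rewrite hE ler_qexp.
  by move: (eb_h (k0 + k)%N) (ep_h (k0 + k)%N) => /andP[_ +] /andP[+ _]; lra.
have be_le k : abs (xi - be k) <= E (- v * ht (quad (a' k) (b' k) (c' k)) + 2 * K).
  have [_ _ _ ->] := albe k; rewrite hE ler_qexp.
  by move: (eb_h (k0 + k)%N) (ea_h (k0 + k)%N) => /andP[_ +] /andP[+ _]; lra.
have be_ge k : E (- v * ht (quad (a' k) (b' k) (c' k)) - 2 * K) <= abs (xi - be k).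
  have [_ _ _ ->] := albe k; rewrite hE ler_qexp.
  by move: (eb_h (k0 + k)%N) (ea_h (k0 + k)%N) => /andP[+ _] /andP[_ +]; lra.
have G_le k : abs (peval (quad (a' k) (b' k) (c' k)) xi) <=
    E (- (w + v) * ht (quad (a' k) (b' k) (c' k)) + 2 * K).
  by rewrite hp hE ler_qexp; move: (ep_h (k0 + k)%N) => /andP[_ +]; lra.
have G_ge k : E (- (w + v) * ht (quad (a' k) (b' k) (c' k)) - 2 * K) <=
    abs (peval (quad (a' k) (b' k) (c' k)) xi).
  by rewrite hp hE ler_qexp; move: (ep_h (k0 + k)%N) => /andP[+ _]; lra.
have grow' k : ht (quad (a' k.+1) (b' k.+1) (c' k.+1)) <=
    r * ht (quad (a' k) (b' k) (c' k)) + 2 * K.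
  by have := grow (k0 + k)%N; rewrite !hE addnS; lra.
have unb' M : exists k, M < ht (quad (a' k) (b' k) (c' k)).
  have [k1 hk1] := unb M; exists k1; rewrite hE; apply: hk1; exact: leq_addl.
have lw := wnstar_ge w0 a0' uni' Eb' Ec' dvd' al_le al_ge unb' n2.
have lwv := wn_ge a0' G_le G_ge unb' n2.
split=> // D0 Dw; split; apply/le_anti; rewrite ?lw ?lwv andbT.
- exact: (wnstar_le K2 r0 w0 v0 v1 xiK2 a0' Eb' Ec' dvd' al_le al_ge be_le be_ge
            grow' unb' n2 D0 Dw).
- exact: (wn_le K2 r0 w0 v0 v1 xiK2 a0' Eb' Ec' dvd' al_le be_le G_ge
            grow' unb' n2 D0 Dw).
Qed.

End FromForms.

Section ContinuedFractions.
Variables (F : finFieldType) (R : realType) (V : valued_closure F R).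
Local Notation abs := (vc_abs V).
Local Notation emb := (vc_emb V).
Local Notation E := (qexp F).
Variable p : nat -> {poly F}.
Hypothesis p_size : forall n, size (p n) = 2%N.

Lemma abs_letter n : abs (emb (p n)) = E 1.
Proof.
by rewrite abs_emb -?size_poly_eq0 /pdeg ?p_size.
Qed.

Lemma cf_from_abs n k : abs (cf_from V p k n) = E 1.
Proof.
elim: n k => [|n IH] k /=; first exact: abs_letter.
rewrite absD_dom ?abs_letter // absV IH -qexpN ltr_qexp; lra.
Qed.

Definition cf_tail_limit k (y : V) := forall e : R, 0 < e ->
  exists N : nat, forall n, (N <= n)%N -> abs (y - cf_from V p k n) < e.

Lemma cf_tail_step k y : cf_tail_limit k y ->
  abs (y - emb (p k)) = E (-1) /\ cf_tail_limit k.+1 (y - emb (p k))^-1.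
Proof.
move=> lim; set z := y - emb (p k).
have near e : 0 < e -> exists N : nat, forall n, (N <= n)%N ->
    abs (z - (cf_from V p k.+1 n)^-1) < e.
  move=> /lim [N hN]; exists N => n Nn.
  by have := hN n.+1 (leqW Nn); rewrite /= opprD addrA.
have zE : abs z = E (-1).
  have [N /(_ N (leqnn _)) hN] := near _ (qexp_gt0 F (-1)).
  have cE : abs (cf_from V p k.+1 N)^-1 = E (-1) by rewrite absV cf_from_abs qexpN.
  by rewrite -(subrK (cf_from V p k.+1 N)^-1 z) addrC absD_dom cE.
split=> // e e0.
(* Inversion magnifies the distance by |z|^(-1) |c| = q^2. *)
have [N hN] := near (e * E (-2)) (mulr_gt0 e0 (qexp_gt0 F _)).
exists N => n /hN; set c := cf_from V p k.+1 n => lt1.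
have c0 : c != 0 by rewrite -abs_gt0 cf_from_abs qexp_gt0.
have z0 : z != 0 by rewrite -abs_gt0 zE qexp_gt0.
have -> : z^-1 - c = - (z^-1 * c * (z - c^-1)) by field; rewrite z0 c0.
rewrite absN !vc_absM absV zE cf_from_abs -qexpN -qexpD.
have := lt1; rewrite -(ltr_pM2l (qexp_gt0 F 2)) mulrCA -qexpD subrr qexp0 mulr1.
by apply: le_lt_trans; rewrite opprK; lra.
Qed.

Lemma complete_quotients (xi : V) : cf_limit p xi -> exists x : nat -> V,
  [/\ x 0%N = xi, forall n, x n = emb (p n) + (x n.+1)^-1
    & forall n, abs (x n) = E 1].
Proof.
move=> lim; pose x := fix x n := if n is n'.+1 then (x n' - emb (p n'))^-1 else xi.
have xlim n : cf_tail_limit n (x n).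
  by elim: n => [|n /cf_tail_step[]].
have xE n : x n = emb (p n) + (x n.+1)^-1 by rewrite /= invrK addrC subrK.
exists x; split=> // n; rewrite xE absD_dom ?abs_letter //= invrK.
have [-> _] := cf_tail_step (xlim n); rewrite ltr_qexp; lra.
Qed.

Variable x : nat -> V.
Hypothesis xE : forall n, x n = emb (p n) + (x n.+1)^-1.
Hypothesis x_abs : forall n, abs (x n) = E 1.

Lemma complete_quotient_neq0 n : x n != 0.
Proof. by rewrite -abs_gt0 x_abs qexp_gt0. Qed.

(* Infinite descent on u: the numerator of u * x n - t, read in the next
   complete quotient, is a pair with a strictly smaller first entry. *)
Lemma complete_quotient_badly_approximable n : badly_approximable (x n).
Proof.
move=> u t; have [m] := ubnP (size u); elim: m u t n => // m IH u t n ltm u0.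
pose u' := u * p n - t.
have dE : emb u * x n - emb t = emb u' + emb u * (x n.+1)^-1.
  by rewrite xE rmorphB rmorphM; ring.
have uE : abs (emb u) = E (pdeg R u) by rewrite abs_emb.
have d0 : 0 <= pdeg R u := ler0n _ _.
have uxE : abs (emb u * (x n.+1)^-1) = E (pdeg R u - 1).
  by rewrite vc_absM absV x_abs uE -qexpN -qexpD.
have [u'0|u'0] := eqVneq u' 0.
  by rewrite dE u'0 rmorph0 add0r uxE uE -qexpD ler_qexp; lra.
rewrite leNgt; apply/negP => lt1.
have lt2 : abs (emb u * x n - emb t) < E (-1 - pdeg R u).
  rewrite -(ltr_pM2r (qexp_gt0 F (pdeg R u))) -qexpD subrK -uE; exact: lt1.
have le3 : abs (emb u') <= E (pdeg R u - 1).
  have -> : emb u' = (emb u * x n - emb t) - emb u * (x n.+1)^-1 by rewrite dE addrK.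
  apply: absB_le; last by rewrite uxE.
  by apply: le_trans (ltW lt2) _; rewrite ler_qexp; lra.
have le4 : pdeg R u' <= pdeg R u - 1 by rewrite -(ler_qexp F) -(abs_emb V).
have ltu' : (size u' < m)%N.
  move: le4; rewrite lerBrDr natr1 ler_nat; move: ltm u0 u'0.
  by rewrite -!size_poly_gt0; lia.
have := IH u' (- u) n.+1 ltu' u'0.
have -> : emb u' * x n.+1 - emb (- u) = x n.+1 * (emb u * x n - emb t).
  rewrite dE rmorphN mulrDr; field; exact: complete_quotient_neq0.
rewrite vc_absM x_abs => le5.
have lt6 : E 1 * abs (emb u * x n - emb t) * E (pdeg R u - 1) <
    E 1 * E (-1 - pdeg R u) * E (pdeg R u - 1).
  by rewrite ltr_pM2r ?qexp_gt0 // ltr_pM2l ?qexp_gt0.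
have : E (-1) < E 1 * E (-1 - pdeg R u) * E (pdeg R u - 1).
  apply: le_lt_trans le5 (le_lt_trans _ lt6).
  by rewrite ler_wpM2l // mulr_ge0 ?qexp_ge0 ?vc_abs_ge0.
by rewrite -!qexpD ltr_qexp; lra.
Qed.

Hypothesis F2 : 2%:R = 0 :> F.

(** Putting X = p + 1/Y in a X^2 + B X + c and clearing denominators gives (a p^2 + B p + c) Y^2 + B
    Y + a in characteristic 2. The leading coefficient of a form is the constant coefficient of the
    next, so one sequence g, with form (g (j+1), B, g j) at index j, records the whole chain. *)
Definition form_chain (B : {poly F}) (g : nat -> {poly F}) M N :=
  forall j, (M <= j < N)%N -> g j = g j.+2 + p j * B + p j ^+ 2 * g j.+1.

Local Notation S B g j := (quad (g j.+1) B (g j)).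

Lemma peval_form_step B g j :
  g j = g j.+2 + p j * B + p j ^+ 2 * g j.+1 ->
  peval (S B g j) (x j) = peval (S B g j.+1) (x j.+1) * (x j.+1)^-1 ^+ 2.
Proof.
move=> gj; rewrite !peval_quad gj xE.
have x0 := complete_quotient_neq0 j.+1; move: (x j.+1) x0 => y y0.
(* The multiple of 2 by which the two sides differ is written out, then removed by the
   characteristic. *)
transitivity ((emb (g j.+2) * y ^+ 2 + emb B * y + emb (g j.+1)) * y^-1 ^+ 2 +
  2%:R * (emb (p j) ^+ 2 * emb (g j.+1) + emb (p j) * y^-1 * emb (g j.+1) +
    emb B * emb (p j))); last by rewrite (closure_char2 V F2) mul0r addr0.
by rewrite !rmorphD !rmorphM; field.
Qed.

Lemma abs_form_chain B g M N : (M <= N)%N -> form_chain B g M N ->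
  abs (peval (S B g M) (x M)) = abs (peval (S B g N) (x N)) * E (- 2 * (N - M)%:R).
Proof.
move=> MN; have [d -> {N MN}] : exists d, N = (M + d)%N by exists (N - M)%N; rewrite subnKC.
rewrite addKn; elim: d => [|d IH] chain.
  by rewrite addn0 mulr0 qexp0 mulr1.
rewrite IH; last by move=> j /andP[? ?]; apply: chain; lia.
rewrite peval_form_step; last by apply: chain; lia.
rewrite vc_absM absX absV x_abs -qexpN qexp_exp addnS -mulrA -qexpD; congr (_ * E _).
by rewrite -natr1; ring.
Qed.

Lemma unimodular_form_chain B g M N : (M <= N)%N -> form_chain B g M N ->
  unimodular (g N.+1) B (g N) -> unimodular (g M.+1) B (g M).
Proof.
move=> MN; have [d -> {N MN}] : exists d, N = (M + d)%N by exists (N - M)%N; rewrite subnKC.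
elim: d => [|d IH] chain; first by rewrite addn0.
rewrite addnS => -[s [t [u E1]]]; apply: IH.
  by move=> j /andP[? ?]; apply: chain; lia.
(* Obtained by solving the recurrence for g (j+2) and substituting in the relation. *)
exists (u - s * p (M + d)%N ^+ 2), (t - s * p (M + d)%N), s.
rewrite -E1 (chain (M + d)%N); last by lia.
ring.
Qed.

Lemma extend_form_chain B M u v : exists g,
  [/\ g M.+1 = u, g M = v & form_chain B g 0 M].
Proof.
elim: M u v => [|M IH] u v.
  by exists (fun j => if j is 0 then v else u).
have [g [g1 g0 chain]] := IH v (u + p M * B + p M ^+ 2 * v).
exists (fun j => if (j <= M.+1)%N then g j else u); split.
- by rewrite ltnn.
- by rewrite leqnn.
- move=> j /andP[_ jM]; rewrite ltnS in jM.
  rewrite (leqW jM) (_ : (j < M.+1)%N = true) //.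
  have [jM'|jM'] := ltnP j M.
    by rewrite (_ : (j.+1 < M.+1)%N = true) //; apply: chain.
  have -> : j = M by apply/eqP; rewrite eqn_leq jM.
  by rewrite ltnn g0 g1.
Qed.

(** Going backwards, p j ^+ 2 * g (j+1) dominates the recurrence, so every letter adds two degrees;
    the hypotheses at M start this regime. *)
Lemma size_form_chain B g M : form_chain B g 0 M ->
  (size (g M.+1) + 2 = size (g M))%N -> (size B <= size (g M))%N ->
  (size (g 1%N) + 2 = size (g 0%N))%N /\ (size (g 0%N) = size (g M) + M.*2)%N.
Proof.
move=> chain s1 sB.
suff H d : (d <= M)%N -> (size (g (M - d).+1) + 2 = size (g (M - d)%N))%N /\
    (size (g (M - d)%N) = size (g M) + d.*2)%N.
  by have := H M (leqnn _); rewrite subnn.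
elim: d => [|d IH] dM; first by rewrite subn0 addn0.
have {IH} := IH (ltnW dM).
have -> : (M - d = (M - d.+1).+1)%N by lia.
set j := (M - d.+1)%N => -[e1 e2].
have jM : (0 <= j < M)%N by rewrite /j; lia.
have g0 : g j.+1 != 0 by rewrite -size_poly_gt0; lia.
have p0 : p j != 0 by rewrite -size_poly_gt0 p_size.
have sp2 : size (p j ^+ 2) = 3%N by rewrite expr2 size_mul // p_size.
have s3 : size (p j ^+ 2 * g j.+1) = (size (g j.+1) + 2)%N.
  by rewrite size_mul ?expf_neq0 // sp2 addn2.
have spB : (size (p j * B)%R <= (size B).+1)%N.
  by apply: leq_trans (size_polyMleq _ _) _; rewrite p_size.
have sj : size (g j) = (size (g j.+1) + 2)%N.
  rewrite (chain j jM) addrC size_polyDl s3 //.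
  apply: leq_ltn_trans (size_polyD _ _) _; rewrite gtn_max; lia.
by rewrite sj e2; lia.
Qed.

(** Applied with M and N the places where the expansion of [Phi] deviates from a periodic one, g
    being the chain of the periodic number in between. The deviation at M makes the degree jump by
    two and every letter before it adds two more; the deviation at N determines f. *)
Lemma forms_from_base B g M N (f : R) : (M <= N)%N -> B != 0 ->
  form_chain B g M N ->
  g M.+1 != 0 -> (size (g M.+1) + 2 = size (g M))%N -> (size B <= size (g M))%N ->
  unimodular (g N.+1) B (g N) -> abs (peval (S B g N) (x N)) = E f ->
  exists a c, [/\ unimodular a B c,
    abs (emb a) = E ((size (g M))%:R - 3 + 2 * M%:R),
    ht R (quad a B c) = (size (g M))%:R - 1 + 2 * M%:R
    & abs (peval (quad a B c) (x 0%N)) = E (f - 2 * N%:R)].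
Proof.
move=> MN B0 chain g0 s1 sB uni fE.
have [g' [g'1 g'0 chain']] := extend_form_chain B M (g M.+1) (g M).
have sB' : (0 < size B)%N by rewrite size_poly_gt0.
have [e1 e2] := size_form_chain chain' (ltac:(by rewrite g'1 g'0)) (ltac:(by rewrite g'0)).
rewrite g'0 in e2.
have lt2 : (2 < size (g M))%N by rewrite -s1 -size_poly_gt0 in g0 *; lia.
exists (g' 1%N), (g' 0%N); split.
- apply: (unimodular_form_chain (leq0n M) chain'); rewrite g'1 g'0.
  exact: unimodular_form_chain uni.
- rewrite abs_emb -?size_poly_gt0; last by lia.
  have -> : pdeg R (g' 1%N) = ((size (g M) + M.*2) - 3)%:R by congr (_%:R); lia.
  by rewrite natrB ?natrD -?mul2n ?natrM; [congr E; ring|lia].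
- rewrite /ht sizeY_quad.
  have -> : maxn (size (g' 0%N)) (maxn (size B) (size (g' 1%N))) = (size (g M) + M.*2)%N.
    by lia.
  by rewrite -subn1 natrB ?natrD -?mul2n ?natrM; [ring|lia].
- rewrite (abs_form_chain (leq0n M) chain') g'1 g'0 (abs_form_chain MN chain) fE.
  rewrite -!qexpD subn0 natrB //; congr E; ring.
Qed.

End ContinuedFractions.

(** * The self-similar sequence of partial quotients *)

Section SelfSimilarWord.
Variables (F : fieldType) (l r : nat) (mu : nat -> F).
Hypotheses (l0 : (0 < l)%N) (r0 : (0 < r)%N).
Hypothesis mu_head : forall i, mu (l + r * i)%N = mu i ^+ r.
Hypothesis mu_tail : forall i j, (0 < j < r)%N -> mu (l + r * i + j)%N = 1.

Fixpoint level_start k := if k is k'.+1 then (l + r * level_start k')%N else 0%N.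

(** Past its first l letters the word is its own image under the substitution replacing c by c^r
    followed by r - 1 ones; this is the k-th iterate. *)
Lemma mu_level k i : mu (level_start k + i * r ^ k)%N = mu i ^+ (r ^ k) /\
  forall j, (0 < j < r ^ k)%N -> mu (level_start k + i * r ^ k + j)%N = 1.
Proof.
elim: k i => [|k IH] i.
  by rewrite /= expn0 muln1 expr1; split=> // j; rewrite ltnS leqn0; case: j.
have [IH1 IH2] := IH i.
split.
  by rewrite /= -addnA expnSr mulnA [(_ * r)%N]mulnC -mulnDr mu_head IH1 -exprM.
move=> j /andP[j0 jr].
have Ej : j = (r * (j %/ r) + j %% r)%N by rewrite mulnC -divn_eq.
have -> : (level_start k.+1 + i * r ^ k.+1 + j =
    l + r * (level_start k + i * r ^ k + j %/ r) + j %% r)%N.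
  by rewrite {1}Ej /= expnS; ring.
have [m0|m0] := posnP (j %% r); last by rewrite mu_tail // m0 ltn_pmod.
rewrite m0 addn0 mu_head IH2 ?expr1n //.
rewrite ltn_divLR // -expnSr jr andbT.
by rewrite lt0n; apply: contraTneq j0 => q0; rewrite Ej q0 m0 muln0.
Qed.

Lemma mu_neq0 : (forall i, (i < l)%N -> mu i != 0) -> forall i, mu i != 0.
Proof.
move=> nz i; have [n] := ubnP i; elim: n i => // n IH i lti.
have [/nz //|li] := ltnP i l.
have Ei : i = (l + r * ((i - l) %/ r) + (i - l) %% r)%N.
  by rewrite -addnA [(r * _)%N]mulnC -divn_eq subnKC.
rewrite Ei; have [m0|m0] := posnP ((i - l) %% r).
  rewrite m0 addn0 mu_head expf_neq0 // IH //.
  have := leq_div (i - l) r; lia.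
by rewrite mu_tail ?oner_neq0 // m0 ltn_pmod.
Qed.

Lemma level_startE k : ((r - 1) * level_start k = l * (r ^ k - 1))%N.
Proof.
elim: k => [|k IH] /=; first by rewrite expn0 muln0 muln0.
have rk : (0 < r ^ k)%N by rewrite expn_gt0 r0.
rewrite mulnDr mulnCA IH expnS; case: (r) r0 rk => // r' _ rk.
by case: (r'.+1 ^ k)%N rk => // a _; rewrite mulnS addSn !subn1 /=; ring.
Qed.

Lemma level_start_ge k : (k <= level_start k)%N.
Proof. by elim: k => //= k IH; nia. Qed.

Lemma level_startR (R : realType) k :
  (r%:R - 1) * (level_start k)%:R = l%:R * (r%:R ^+ k - 1) :> R.
Proof.
have := congr1 (fun n : nat => n%:R : R) (level_startE k).
by rewrite !natrM !natrB ?expn_gt0 ?r0 // natrX.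
Qed.

Lemma level_start_unbounded (R : realType) (M : R) : exists k0, forall k, (k0 <= k)%N ->
  M < (level_start k)%:R.
Proof.
exists (Num.truncn M).+1 => k hk.
have hM : M < (Num.truncn M).+1%:R by exact: truncnS_gt.
by apply: lt_le_trans hM _; rewrite ler_nat (leq_trans hk) // level_start_ge.
Qed.

End SelfSimilarWord.

Section CharTwo.
Variable F : fieldType.
Hypothesis F2 : 2%:R = 0 :> F.

Lemma char2_polyD (x : {poly F}) : x + x = 0.
Proof. by rewrite -mulr2n -mulr_natr -polyCMn F2 polyC0 mulr0. Qed.

Lemma char2_sqrD_neq0 (e : F) : e != 0 -> e != 1 -> e ^+ 2 + e != 0.
Proof.
move=> e0 e1; have -> : e ^+ 2 + e = e * (e - 1) + 2%:R * e by ring.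
by rewrite F2 mul0r addr0 mulf_neq0 // subr_eq0.
Qed.

Lemma char2_expr2n_eq1 (e : F) n : (e ^+ (2 ^ n) == 1) = (e == 1).
Proof.
elim: n => [|n IH]; first by rewrite expn0 expr1.
rewrite expnSr exprM -IH; set y := e ^+ _.
have -> : (y ^+ 2 == 1) = ((y - 1) ^+ 2 == 0).
  rewrite -[in LHS]subr_eq0; congr (_ == 0).
  have -> : y ^+ 2 - 1 = (y - 1) ^+ 2 + 2%:R * (y - 1) by ring.
  by rewrite F2 mul0r addr0.
by rewrite expf_eq0 subr_eq0.
Qed.

End CharTwo.

(** * Case (1): blocks of partial quotients equal to T *)

Section Letters.
Variables (F : finFieldType) (R : realType) (V : valued_closure F R).
Local Notation abs := (vc_abs V).
Local Notation emb := (vc_emb V).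
Local Notation E := (qexp F).
Variables (l t : nat) (mu : nat -> F) (xi : V).
Local Notation r := (2 ^ t)%N.
Hypotheses (l0 : (0 < l)%N) (t0 : (0 < t)%N).
Hypothesis F2 : 2%:R = 0 :> F.
Hypothesis mu_head : forall i, mu (l + r * i)%N = mu i ^+ r.
Hypothesis mu_tail : forall i j, (0 < j < r)%N -> mu (l + r * i + j)%N = 1.
Hypothesis mu0 : forall i, mu i != 0.
Local Notation p := (fun i => (mu i)%:P * 'X).
Hypothesis xi_lim : cf_limit p xi.
Local Notation start := (level_start l r).

Lemma size_CX (e : F) : e != 0 -> size (e%:P * 'X) = 2%N.
Proof. by move=> e0; rewrite size_Cmul // size_polyX. Qed.

Let r_gt0 : (0 < r)%N. Proof. by rewrite expn_gt0. Qed.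
Let r_gt1 : (1 < r)%N. Proof. by rewrite -(expn0 2) ltn_exp2l. Qed.

Lemma peval_quad_shift (u b c q : {poly F}) (e : V) :
  peval (quad u b c) (emb q + e) =
    emb (u * q ^+ 2 + b * q + c) + (emb u * e ^+ 2 + emb b * e).
Proof.
rewrite peval_quad !rmorphD !rmorphM.
transitivity (emb u * (emb q * emb q) + emb b * emb q + emb c +
  (emb u * e ^+ 2 + emb b * e) + 2%:R * (emb u * emb q * e)); first by ring.
by rewrite (closure_char2 V F2) mul0r addr0.
Qed.

Section InitialOnes.
Variable m : nat.
Hypotheses (m0 : (0 < m)%N) (mu00 : mu 0 != 1) (mum : mu m != 1).
Hypothesis mu1 : forall i, (0 < i < m)%N -> mu i = 1.

(** The comparison number is [T, T, ...], a root of X^2 + T X + 1, whose chain is constantly 1. At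
    level k the first m letters expand to T strictly between M and N, while the letters at M and N
    are e T with e != 1. There (e^2 + e) T^2 survives, which gives degree 2 to [g M] and size q^2 to
    the value at N. *)
Lemma initial_ones_forms (x : nat -> V) k :
  x 0%N = xi -> (forall n, x n = emb (p n) + (x n.+1)^-1) ->
  (forall n, abs (x n) = E 1) ->
  exists a c, [/\ unimodular a 'X c, abs (emb a) = E (2 * (start k)%:R),
    ht R (quad a 'X c) = 2 + 2 * (start k)%:R
    & abs (peval (quad a 'X c) xi) = E (2 - 2 * (start k + m * r ^ k)%N%:R)].
Proof.
move=> x0 xE xabs; set M := start k; set N := (M + m * r ^ k)%N.
have rk : (0 < r ^ k)%N by rewrite expn_gt0 r_gt0.
have MN : (M < N)%N by rewrite /N -[X in (X < _)%N]addn0 ltn_add2l muln_gt0 m0.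
have p_size n : size (p n) = 2%N by exact: size_CX.
have muM : mu M != 1.
  have [+ _] := mu_level r_gt0 mu_head mu_tail k 0.
  by rewrite mul0n addn0 -/M => ->; rewrite -expnM (char2_expr2n_eq1 F2).
have muN : mu N != 1.
  have [+ _] := mu_level r_gt0 mu_head mu_tail k m.
  by rewrite -/M -/N => ->; rewrite -expnM (char2_expr2n_eq1 F2).
have mu_mid j : (M < j < N)%N -> mu j = 1.
  move=> /andP[Mj jN].
  have Ej : j = (M + (j - M) %/ r ^ k * r ^ k + (j - M) %% r ^ k)%N.
    by rewrite -addnA -divn_eq subnKC // ltnW.
  have [L1 L2] := mu_level r_gt0 mu_head mu_tail k ((j - M) %/ r ^ k).
  have ltm : ((j - M) %/ r ^ k < m)%N.
    by rewrite ltn_divLR //; rewrite /N in jN; lia.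
  have [e0|e0] := posnP ((j - M) %% r ^ k); rewrite Ej; last first.
    by rewrite L2 // e0 ltn_pmod.
  rewrite e0 addn0 L1 mu1 ?expr1n // ltm andbT lt0n.
  by apply: contraTneq Mj => q0; rewrite Ej q0 e0 mul0n !addn0 ltnn.
pose top (e : F) : {poly F} := 1 + (e%:P * 'X) * 'X + (e%:P * 'X) ^+ 2.
have topE e : top e = (e ^+ 2 + e)%:P * 'X^2 + 1.
  by rewrite /top polyCD polyC_exp; ring.
have size_top e : e != 0 -> e != 1 -> size (top e) = 3%N.
  move=> e0 e1; rewrite topE.
  have s3 : size ((e ^+ 2 + e)%:P * 'X^2) = 3%N.
    by rewrite size_Cmul ?size_polyXn // char2_sqrD_neq0.
  by rewrite size_polyDl s3 // size_poly1.
pose g j : {poly F} := if (j <= M)%N then top (mu M) else 1.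
have gM : g M = top (mu M) by rewrite /g leqnn.
have g1 j : (M < j)%N -> g j = 1 by move=> Mj; rewrite /g leqNgt Mj.
have chain : form_chain p 'X g M N.
  move=> j /andP[Mj jN]; rewrite ![g j.+1]g1 ?[g j.+2]g1 // ?mulr1 //; last by lia.
  move: Mj; rewrite leq_eqVlt => /orP[/eqP <-|Mj]; first by rewrite gM.
  rewrite g1 // mu_mid ?Mj // polyC1 mul1r -expr2 -addrA char2_polyD //.
  by rewrite addr0.
have uni : unimodular (g N.+1) 'X (g N).
  by rewrite !g1 ?ltnS ?(ltnW MN) //; exists 1, 0, 0; rewrite !mul0r !addr0 mulr1.
have fN : abs (peval (quad (g N.+1) 'X (g N)) (x N)) = E 2.
  rewrite !g1 ?ltnS ?(ltnW MN) //.
  have tE : abs (x N.+1)^-1 = E (-1) by rewrite absV xabs qexpN.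
  have ttE : abs ((x N.+1)^-1 ^+ 2) <= E 0.
    by rewrite absX tE qexp_exp ler_qexp; lra.
  have XE : abs (emb 'X) = E 1 by rewrite abs_emb ?polyX_eq0 // /pdeg size_polyX.
  rewrite xE peval_quad_shift (_ : 1 * _ ^+ 2 + _ + 1 = top (mu N)); last first.
    by rewrite /top; ring.
  have topN : abs (emb (top (mu N))) = E 2.
    by rewrite abs_emb -?size_poly_gt0 /pdeg size_top.
  rewrite absD_dom topN //; apply: (@le_lt_trans _ _ (E 0)); last by rewrite ltr_qexp.
  apply: absD_le; first by rewrite rmorph1 mul1r.
  by rewrite vc_absM XE tE -qexpD ler_qexp; lra.
have gM1 : g M.+1 != 0 by rewrite g1 // oner_neq0.
have szM1 : (size (g M.+1) + 2 = size (g M))%N.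
  by rewrite g1 // gM size_top // size_poly1.
have szX : (size ('X : {poly F}) <= size (g M))%N by rewrite gM size_top // size_polyX.
have [a [c []]] := forms_from_base p_size xE xabs F2 (ltnW MN)
  (negbT (polyX_eq0 F)) chain gM1 szM1 szX uni fN.
rewrite gM size_top // x0 => u1 u2 u3 u4; exists a, c; split=> //.
- by rewrite u2; congr E; ring.
- by rewrite u3; ring.
Qed.

(** The bounded middle coefficient gives v = 1. The height exponent is about 2 [start k], the value
    exponent about -2 ([start k] + m r^k), and r^k is asymptotic to (r - 1) [start k] / l; this
    yields w. *)
Lemma initial_ones_exponents (w := m%:R / l%:R * (r%:R - 1) : R) n : (2 <= n)%N ->
  ((w%:E <= wnstar n xi)%E /\ ((w + 1)%:E <= wn n xi)%E) /\
  (0 < 1 + w + 1 - n%:R ->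
   2 * r%:R * (n%:R - 1) <= (1 + w + 1 - n%:R) * (w - 1) ->
   wnstar n xi = w%:E /\ wn n xi = (w + 1)%:E).
Proof.
have p_size j : size (p j) = 2%N by exact: size_CX.
have [x [x0 xE xabs]] := complete_quotients p_size xi_lim.
have bad : badly_approximable xi.
  by rewrite -x0; exact: (@complete_quotient_badly_approximable F R V p x xE xabs 0%N).
have /choice [a /choice [c ac]] k := initial_ones_forms k x0 xE xabs.
have l1 : 0 < l%:R :> R by rewrite ltr0n.
have m1 : 0 < m%:R :> R by rewrite ltr0n.
have r1 : 1 < r%:R :> R by rewrite ltr1n.
have w0 : 0 < w by rewrite mulr_gt0 ?divr_gt0 // subr_gt0.
have sk k : m%:R * r%:R ^+ k = m%:R + w * (start k)%:R :> R.
  have := level_startR l r_gt0 R k.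
  rewrite /w => e1; apply: (@mulfI _ l%:R); first by rewrite gt_eqF.
  have -> : l%:R * (m%:R + m%:R / l%:R * (r%:R - 1) * (start k)%:R) =
    l%:R * m%:R + m%:R * ((r%:R - 1) * (start k)%:R) :> R.
    by field; rewrite gt_eqF.
  by rewrite e1; ring.
pose K : R := 4 + 2 * w + 2 * m%:R + 2 * l%:R.
apply: (@exponents_of_forms F R V xi a (fun=> 'X) c w 1 r%:R K
  (fun k => 2 * (start k)%:R) (fun=> 1)
  (fun k => 2 - 2 * (start k + m * r ^ k)%N%:R)) => //.
- by rewrite /K; lra.
- lra.
- by rewrite -x0 xabs ler_qexp /K; lra.
- by move=> k; have [] := ac k.
- by move=> k; have [] := ac k.
- by move=> k; rewrite abs_emb ?polyX_eq0 // /pdeg size_polyX.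
- by move=> k; have [] := ac k.
- by move=> k; have [_ _ -> _] := ac k; apply/andP; split; rewrite /K; lra.
- by move=> k; rewrite subrr mul0r /K; apply/andP; split; lra.
- move=> k; have [_ _ -> _] := ac k.
  rewrite natrD natrM natrX sk /K.
  by apply/andP; split; lra.
- move=> k; have [_ _ -> _] := ac k; have [_ _ -> _] := ac k.+1.
  by rewrite /= natrD natrM /K; lra.
- move=> M; have [k0 hk0] := level_start_unbounded l0 r_gt0 M.
  exists k0 => k /hk0; have [_ _ -> _] := ac k.
  by have : 0 <= (start k)%:R :> R := ler0n _ _; lra.
Qed.

End InitialOnes.
End Letters.

(** * Fibonacci polynomials and the periodic expansion for case (2) *)

Section FibonacciPolynomials.
Variable F : finFieldType.
Hypothesis F2 : 2%:R = 0 :> F.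
Implicit Type p : {poly F}.

(** The continuants of T, T, ...; in characteristic 2 they are monomials at powers of 2, which makes
    the periodic forms explicit. *)
Fixpoint fibX n : {poly F} :=
  if n is n'.+1 then if n' is n''.+1 then 'X * fibX n' + fibX n'' else 1 else 0.

Lemma fibXSS n : fibX n.+2 = 'X * fibX n.+1 + fibX n. Proof. by []. Qed.

Lemma char2_poly2 p : 2%:R * p = 0.
Proof. by rewrite mulr_natl mulr2n char2_polyD. Qed.

Lemma fibX_sqr n : fibX n.+2 ^+ 2 = 'X^2 * fibX n.+1 ^+ 2 + fibX n ^+ 2.
Proof.
rewrite fibXSS -[RHS]addr0 -(char2_poly2 ('X * fibX n.+1 * fibX n)); ring.
Qed.

Lemma fibX_double n : fibX n.*2 = 'X * fibX n ^+ 2 /\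
  fibX n.*2.+1 = fibX n.+1 ^+ 2 + fibX n ^+ 2.
Proof.
elim: n => [|n [IH1 IH2]].
  by rewrite /= !expr0n /= mulr0 addr0 expr1n.
have E1 : fibX n.+1.*2 = 'X * fibX n.+1 ^+ 2.
  rewrite doubleS fibXSS IH1 IH2 -[RHS]addr0 -(char2_poly2 ('X * fibX n ^+ 2)); ring.
split=> //.
rewrite doubleS (fibXSS n.*2.+1) -doubleS E1 IH2 fibX_sqr; ring.
Qed.

Lemma fibX_pow2 n : fibX (2 ^ n) = 'X^(2 ^ n - 1).
Proof.
elim: n => [|n IH]; first by rewrite expn0 subnn expr0.
rewrite expnS mul2n (fibX_double _).1 IH -exprM -exprS; congr (_ ^+ _).
have n0 : (0 < 2 ^ n)%N by rewrite expn_gt0.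
lia.
Qed.

Lemma size_fibX n : size (fibX n) = n.
Proof.
suff: size (fibX n) = n /\ size (fibX n.+1) = n.+1 by case.
elim: n => [|n [IH1 IH2]]; first by rewrite size_poly0 size_poly1.
split=> //; rewrite fibXSS mulrC.
have s2 : size (fibX n.+1 * 'X) = n.+2.
  by rewrite size_mulX ?IH2 // -size_poly_gt0 IH2.
by rewrite size_polyDl s2 // IH1 leqW.
Qed.

Variables (lam : F) (e : nat).
Local Notation Lh := (2 ^ e)%N.
Local Notation L := (Lh.*2).
Local Notation B := ('X^(L - 1) : {poly F}).

(* Up to the factor 1/lam, the consecutive pairs of [period_coef], together
   with the middle coefficient B, are the quadratic forms of the complete
   quotients of the purely periodic expansion with period
   lam T, T, ..., T of length L; the indices are centered at L/2. *)
Definition period_coef i : {poly F} :=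
  'X^(L - 2) + (1 + lam^-1)%:P * fibX ((Lh - i) + (i - Lh)) ^+ 2.
Local Notation H := period_coef.

Let Lh_gt0 : (0 < Lh)%N. Proof. by rewrite expn_gt0. Qed.

Lemma period_coefL : H L = H 0%N.
Proof. by rewrite /H; congr (_ + _ * fibX _ ^+ 2); lia. Qed.

(** The factor 1 + lam^(-1) in [period_coef] is chosen for this value: the square of fibX (2^e) is
    T^(L - 2), and the two units cancel. *)
Lemma period_coef0 : H 0%N = (lam^-1)%:P * 'X^(L - 2).
Proof.
rewrite /H subn0 sub0n addn0 fibX_pow2 -exprM polyCD.
have -> : ((2 ^ e - 1) * 2 = L - 2)%N by lia.
by rewrite -[RHS]addr0 -(char2_poly2 'X^(L - 2)); ring.
Qed.

Lemma XL1 : 'X * B = 'X^2 * 'X^(L - 2).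
Proof. by rewrite -exprS -exprD; congr (_ ^+ _); lia. Qed.

Lemma XL2 : 'X * B = 'X^L.
Proof. by rewrite -exprS; congr (_ ^+ _); lia. Qed.

(** The monomial part absorbs the middle term, since T B = T^2 T^(L - 2). Squares of [fibX] satisfy
    s_(n+2) = T^2 s_(n+1) + s_n, which in characteristic 2 reads the same backwards, so it applies
    on both sides of the centre. *)
Lemma period_coef_step i : (i.+2 <= L)%N ->
  H i = H i.+2 + 'X * B + 'X^2 * H i.+1.
Proof.
move=> iL; rewrite XL1 /H.
set y := 'X^(L - 2); set nu := (1 + lam^-1)%:P.
suff -> : fibX ((Lh - i) + (i - Lh)) ^+ 2 =
  fibX ((Lh - i.+2) + (i.+2 - Lh)) ^+ 2 +
  'X^2 * fibX ((Lh - i.+1) + (i.+1 - Lh)) ^+ 2.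
  by rewrite -[LHS]addr0 -(char2_poly2 ('X^2 * y)); ring.
have [lt1|] := ltnP i.+1 Lh.
  have -> : (Lh - i + (i - Lh) = (Lh - i.+2).+2)%N by lia.
  have -> : (Lh - i.+1 + (i.+1 - Lh) = (Lh - i.+2).+1)%N by lia.
  have -> : (Lh - i.+2 + (i.+2 - Lh) = Lh - i.+2)%N by lia.
  by rewrite fibX_sqr addrC.
rewrite leq_eqVlt => /orP[/eqP eL|gt1].
  have -> : (Lh - i + (i - Lh) = 1)%N by lia.
  have -> : (Lh - i.+1 + (i.+1 - Lh) = 0)%N by lia.
  have -> : (Lh - i.+2 + (i.+2 - Lh) = 1)%N by lia.
  by rewrite /= expr0n mulr0 addr0.
have -> : (Lh - i + (i - Lh) = i - Lh)%N by lia.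
have -> : (Lh - i.+1 + (i.+1 - Lh) = (i - Lh).+1)%N by lia.
have -> : (Lh - i.+2 + (i.+2 - Lh) = (i - Lh).+2)%N by lia.
rewrite fibX_sqr -[LHS]addr0.
by rewrite -(char2_poly2 ('X^2 * fibX (i - Lh).+1 ^+ 2)); ring.
Qed.

(** The letter lam T closes the period: by the value of H 0 the last two terms are equal and cancel,
    and H (L - 1) = H 1 by symmetry. *)
Lemma period_coef_wrap : lam != 0 ->
  H (L - 1) = H 1%N + (lam%:P * 'X) * B + (lam%:P * 'X) ^+ 2 * H 0%N.
Proof.
move=> lam0.
have -> : H (L - 1) = H 1%N by rewrite /H; congr (_ + _ * fibX _ ^+ 2); lia.
rewrite period_coef0 -addrA -[LHS]addr0; congr (_ + _).
rewrite -mulrA XL1 exprMn -(char2_poly2 (lam%:P * ('X^2 * 'X^(L - 2)))).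
have -> : lam%:P ^+ 2 * 'X^2 * (lam^-1%:P * 'X^(L - 2)) =
  (lam%:P * lam^-1%:P) * (lam%:P * ('X^2 * 'X^(L - 2))) by ring.
by rewrite -polyCM mulfV // polyC1; ring.
Qed.

Lemma nu_neq0 : lam != 1 -> 1 + lam^-1 != 0 :> F.
Proof.
move=> lam1.
have -> : 1 + lam^-1 = lam^-1 - 1 + 2%:R by ring.
by rewrite F2 addr0 subr_eq0 invr_eq1.
Qed.

(** At the centre the two outer coefficients differ by the nonzero constant 1 + lam^(-1); the
    relation then descends along the recurrence. *)
Lemma period_unimodular i : lam != 1 -> (i <= Lh)%N ->
  unimodular (H (Lh - i)) B (H (Lh - i).+1).
Proof.
move=> lam1; elim: i => [|i IH] iL.
  have E0 : H Lh = 'X^(L - 2).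
    by rewrite /H subnn addn0 /= expr0n mulr0 addr0.
  have E1 : H Lh.+1 = 'X^(L - 2) + (1 + lam^-1)%:P.
    rewrite /H (_ : (Lh - Lh.+1 + (Lh.+1 - Lh) = 1)%N); last by lia.
    by rewrite expr1n mulr1.
  rewrite subn0 E0 E1; exists (- ((1 + lam^-1)^-1)%:P), 0, ((1 + lam^-1)^-1)%:P.
  rewrite mulrDr -polyCM mulVf ?nu_neq0 // polyC1; ring.
have [u [v [w E1]]] := IH (ltnW iL).
have Ei : (Lh - i = (Lh - i.+1).+1)%N by lia.
rewrite Ei in E1; set j := (Lh - i.+1)%N in E1 *.
have jL : (j.+2 <= L)%N by rewrite /j; lia.
exists w, (v - w * 'X), (u - w * 'X^2).
rewrite -E1 (period_coef_step jL); ring.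
Qed.

Lemma period_unimodular0 : lam != 1 -> unimodular (H 0%N) B (H (L - 1)).
Proof.
move=> lam1.
have -> : H (L - 1) = H 1%N by rewrite /H; congr (_ + _ * fibX _ ^+ 2); lia.
by have := period_unimodular lam1 (leqnn _); rewrite subnn.
Qed.

Lemma size_fib_sqr d : (size (fibX d ^+ 2)%R <= d.*2 - 1)%N.
Proof.
case: d => [|d]; first by rewrite /= expr0n size_poly0.
apply: leq_trans (size_polyMleq _ _) _; rewrite !size_fibX; lia.
Qed.

Lemma size_nu_fib d c : (size (c%:P * fibX d ^+ 2)%R <= d.*2 - 1)%N.
Proof.
apply: leq_trans (size_fib_sqr d); rewrite mul_polyC.
by have := size_scale_leq c (fibX d ^+ 2).
Qed.

Lemma size_period_coef i : (0 < i < L)%N -> size (H i) = (L - 1)%N.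
Proof.
move=> iL; rewrite /H size_polyDl size_polyXn; first lia.
by apply: leq_ltn_trans (size_nu_fib _ _) _; lia.
Qed.

Lemma size_period_coef_le i : (i <= L)%N -> (size (H i) <= L - 1)%N.
Proof.
move=> iL; apply: leq_trans (size_polyD _ _) _; rewrite geq_max size_polyXn.
by apply/andP; split; [lia|apply: leq_trans (size_nu_fib _ _) _; lia].
Qed.

(** Reading lam T where the period has T leaves the term (lam^2 + lam) T^L, which does not
    cancel. *)
Lemma size_past_period i i' : lam != 0 -> lam != 1 -> (0 < i < L)%N -> (i' <= L)%N ->
  size (H i' + (lam%:P * 'X) * B + (lam%:P * 'X) ^+ 2 * H i) = L.+1.
Proof.
move=> lam0 lam1 iL i'L; set d := (Lh - i + (i - Lh))%N.
have dL : (d < Lh)%N by rewrite /d; lia.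
have -> : H i' + (lam%:P * 'X) * B + (lam%:P * 'X) ^+ 2 * H i =
  (lam ^+ 2 + lam)%:P * 'X^L +
  (H i' + (lam ^+ 2 * (1 + lam^-1))%:P * fibX d ^+ 2 * 'X^2).
  rewrite -mulrA XL2 /(H i) -/d mulrDr exprMn.
  have -> : lam%:P ^+ 2 * 'X^2 * 'X^(L - 2) = lam%:P ^+ 2 * 'X^L.
    by rewrite -XL2 XL1 mulrA.
  by rewrite polyCD !polyCM; ring.
have s1 : size ((lam ^+ 2 + lam)%:P * 'X^L) = L.+1.
  by rewrite size_Cmul ?size_polyXn // char2_sqrD_neq0.
rewrite size_polyDl s1 // ltnS.
apply: leq_trans (size_polyD _ _) _; rewrite geq_max; apply/andP; split.
  by apply: leq_trans (size_period_coef_le i'L) _; lia.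
apply: leq_trans (size_polyMleq _ _) _; rewrite size_polyXn.
have := size_nu_fib d (lam ^+ 2 * (1 + lam^-1)); lia.
Qed.

End FibonacciPolynomials.

(** * Case (2): blocks of full periods *)

Section ConstantHead.
Variables (F : finFieldType) (R : realType) (V : valued_closure F R).
Local Notation abs := (vc_abs V).
Local Notation emb := (vc_emb V).
Local Notation E := (qexp F).
Variables (l t : nat) (mu : nat -> F) (xi : V) (lam : F).
Local Notation r := (2 ^ t)%N.
Hypotheses (l0 : (0 < l)%N) (t0 : (0 < t)%N).
Hypothesis F2 : 2%:R = 0 :> F.
Hypothesis mu_head : forall i, mu (l + r * i)%N = mu i ^+ r.
Hypothesis mu_tail : forall i j, (0 < j < r)%N -> mu (l + r * i + j)%N = 1.
Hypothesis mu0 : forall i, mu i != 0.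
Local Notation p := (fun i => (mu i)%:P * 'X).
Hypothesis xi_lim : cf_limit p xi.
Local Notation start := (level_start l r).
Hypotheses (lam0 : lam != 0) (lam1 : lam != 1) (lamr : lam ^+ r = lam).
Hypothesis mu_lam : forall i, (i < l)%N -> mu i = lam.

Let r_gt0 : (0 < r)%N. Proof. by rewrite expn_gt0. Qed.
Let r_gt1 : (1 < r)%N. Proof. by rewrite -(expn0 2) ltn_exp2l. Qed.

Lemma lam_exp k : lam ^+ (r ^ k) = lam.
Proof. by elim: k => [|k IH]; rewrite ?expn0 ?expr1 // expnSr exprM IH. Qed.

Lemma level_start_next k : start k.+1 = (start k + l * r ^ k)%N.
Proof.
elim: k => [|k IH]; first by rewrite /= muln0 expn0 muln1 addn0.
have startS j : start j.+1 = (l + r * start j)%N by [].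
by rewrite startS {1}IH startS expnS; ring.
Qed.

(** The period is lam T, T, ..., T of length L = r^(k+1). From n0 = [start k.+1] on, the letters 0
    to l, all equal to lam, expand to l + 1 full periods, and [mu l.+1 = 1] ends the agreement at N.
    Before n0 the r^k - 1 ones closing the last block of level k still fit the end of a period;
    agreement begins after the letter lam at M. *)
Lemma constant_head_forms (x : nat -> V) k :
  x 0%N = xi -> (forall n, x n = emb (p n) + (x n.+1)^-1) ->
  (forall n, abs (x n) = E 1) ->
  exists a c, [/\ unimodular a 'X^(r ^ k.+1 - 1) c,
    abs (emb a) = E ((r ^ k.+1)%:R - 2 + 2 * ((start k.+1)%:R - (r ^ k)%:R)),
    ht R (quad a 'X^(r ^ k.+1 - 1) c) =
      (r ^ k.+1)%:R + 2 * ((start k.+1)%:R - (r ^ k)%:R)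
    & abs (peval (quad a 'X^(r ^ k.+1 - 1) c) xi) =
      E ((r ^ k.+1)%:R - 2 * (start k.+1 + l.+1 * r ^ k.+1)%N%:R)].
Proof.
move=> x0 xE xabs.
pose e := (t * k.+1 - 1)%N.
have EL : (r ^ k.+1 = (2 ^ e).*2)%N.
  rewrite -expnM -mul2n -expnS; congr (2 ^ _)%N; rewrite /e; nia.
set P := (r ^ k)%N; set n0 := start k.+1.
have P0 : (0 < P)%N by rewrite expn_gt0 r_gt0.
have PL : (P * 2 <= (2 ^ e).*2)%N by rewrite -EL expnSr leq_mul2l r_gt1 orbT.
have n0E : n0 = (start k + l * P)%N by exact: level_start_next.
rewrite !EL; set L := (2 ^ e).*2 in PL *.
set M := (n0 - P)%N; set N := (n0 + l.+1 * L)%N.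
have Pn0 : (P <= n0)%N by rewrite n0E; nia.
have L0 : (0 < L)%N by lia.
have lL : (L <= l.+1 * L)%N by rewrite leq_pmull.
have MN : (M < N)%N by rewrite /M /N; lia.
have p_size n : size (p n) = 2%N by exact: size_CX.
(* The phase in the period, with the letters lam T at phase L - 1; adding L keeps the subtraction
   exact for j >= M. *)
pose phi j := ((j + L - n0.+1) %% L)%N.
have mu_next i e' : mu (n0 + i * L)%N = mu i ^+ L /\
    ((0 < e' < L)%N -> mu (n0 + i * L + e')%N = 1).
  have [L1 L2] := mu_level r_gt0 mu_head mu_tail k.+1 i.
  by rewrite /L -EL; split=> // /L2.
have lamL : lam ^+ L = lam by rewrite /L -EL lam_exp.
have mul_lam : mu l = lam.
  by have := mu_head 0; rewrite muln0 addn0 (mu_lam l0) lamr.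
have muS1 : mu l.+1 = 1.
  by have := mu_tail 0 (j := 1); rewrite muln0 addn0 addn1; apply.
have muN : mu N = 1 by have [-> _] := mu_next l.+1 0%N; rewrite muS1 expr1n.
have muM : mu M = lam.
  have [+ _] := mu_level r_gt0 mu_head mu_tail k l.-1.
  rewrite (_ : (start k + l.-1 * r ^ k)%N = M) => [->|]; last first.
    by rewrite /M n0E -/P; case: (l) l0 => // l' _; rewrite mulSn /=; lia.
  by rewrite mu_lam ?lam_exp // prednK.
have mu_mid j : (M < j < N)%N -> mu j = if phi j == L.-1 then lam else 1.
  move=> /andP[Mj jN]; have [jn0|jn0] := ltnP j n0.
    have -> : (phi j == L.-1) = false.
      by rewrite /phi modn_small; [apply/eqP; lia|lia].
    have [_ /(_ (j - M)%N)] := mu_level r_gt0 mu_head mu_tail k l.-1.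
    rewrite (_ : (start k + l.-1 * r ^ k + (j - M))%N = j); last first.
      by rewrite /M n0E -/P; case: (l) l0 n0E => // l' _; rewrite mulSn /=; lia.
    by apply; rewrite -/P; lia.
  have Ej : j = (n0 + (j - n0) %/ L * L + (j - n0) %% L)%N.
    by rewrite -addnA -divn_eq subnKC.
  have [L1 L2] := mu_next ((j - n0) %/ L)%N ((j - n0) %% L)%N.
  have phiE : phi j = (((j - n0) %% L + L.-1) %% L)%N.
    by rewrite modnDml /phi; congr (_ %% _)%N; lia.
  have lt1 : ((j - n0) %% L < L)%N by rewrite ltn_pmod.
  have [e0|e0] := posnP ((j - n0) %% L).
    rewrite phiE e0 add0n modn_small ?ltn_predL // eqxx Ej e0 addn0 L1.
    have : ((j - n0) %/ L <= l)%N.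
      by rewrite -ltnS ltn_divLR //; move: jN; rewrite /N; lia.
    by rewrite leq_eqVlt => /orP[/eqP ->|ltl]; rewrite ?mul_lam ?mu_lam.
  rewrite phiE (_ : (_ + L.-1 = ((j - n0) %% L).-1 + L)%N); last by lia.
  rewrite modnDr modn_small; last by lia.
  rewrite (_ : (_ == _) = false); last by apply/eqP; lia.
  by rewrite [in LHS]Ej L2 // e0.
pose H := period_coef lam e.
pose B : {poly F} := 'X^(L - 1).
have phiS j : (M <= j)%N -> phi j.+1 = if phi j == L.-1 then 0%N else (phi j).+1.
  move=> Mj; rewrite /phi (_ : (j.+1 + L - n0.+1 = (j + L - n0.+1) + 1)%N); last by lia.
  rewrite -modnDml addn1; have := ltn_pmod (j + L - n0.+1) L0.
  set m := (_ %% L)%N => lt1; case: eqP => [->|ne].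
    by rewrite prednK // modnn.
  by rewrite modn_small //; lia.
pose gtop := H (phi M.+2) + (lam%:P * 'X) * B + (lam%:P * 'X) ^+ 2 * H (phi M.+1).
pose g j := if (j <= M)%N then gtop else H (phi j).
have gM : g M = gtop by rewrite /g leqnn.
have gH j : (M < j)%N -> g j = H (phi j) by move=> Mj; rewrite /g leqNgt Mj.
have phi_lt j : (phi j < L)%N by rewrite ltn_pmod.
have chain : form_chain p B g M N.
  move=> j /andP[Mj jN]; rewrite (gH j.+1) // (gH j.+2); last by lia.
  move: (Mj); rewrite leq_eqVlt => /orP[/eqP <-|Mj']; first by rewrite gM muM.
  rewrite gH // mu_mid ?Mj' // !phiS //; last by lia.
  have := phi_lt j; set i := phi j => iL.
  have L1 : (L - 1 = L.-1)%N by lia.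
  case: (i =P L.-1) => [->|ne].
    rewrite (_ : (0 == L.-1)%N = false); last by apply/eqP; lia.
    by rewrite /H /B -[L.-1]L1 (period_coef_wrap F2 e lam0).
  rewrite polyC1 mul1r.
  have st := @period_coef_step _ F2 lam e i.
  case: eqP => [iE|_]; last by apply: st; lia.
  have -> : H 0%N = H i.+2.
    by rewrite (_ : i.+2 = L); [rewrite /H /L period_coefL|lia].
  by apply: st; lia.
have phiN : phi N = L.-1.
  rewrite /phi (_ : (N + L - n0.+1 = l.+1 * L + L.-1)%N); last by rewrite /N; lia.
  by rewrite modnMDl modn_small // ltn_predL.
have phiN1 : phi N.+1 = 0%N by rewrite phiS ?phiN ?eqxx // ltnW.
have phiM1 : phi M.+1 = (L - P)%N.
  rewrite /phi (_ : (M.+1 + L - n0.+1 = L - P)%N); last by rewrite /M; lia.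
  by rewrite modn_small //; lia.
have iM1 : (0 < phi M.+1 < L)%N by rewrite phiM1; lia.
have size_gM1 : size (g M.+1) = (L - 1)%N by rewrite gH // size_period_coef.
have size_gM : size (g M) = L.+1.
  by rewrite gM; apply: size_past_period => //; apply: ltnW.
have L1 : (L - 1 = L.-1)%N by lia.
have uni : unimodular (g N.+1) B (g N).
  rewrite !gH ?phiN ?phiN1 ?ltnS ?(ltnW MN) //.
  by rewrite -L1; exact: period_unimodular0.
have fN : abs (peval (quad (g N.+1) B (g N)) (x N)) = E L%:R.
  rewrite !gH ?phiN ?phiN1 ?ltnS ?(ltnW MN) // xE peval_quad_shift //.
  rewrite muN polyC1 mul1r.
  have tE : abs (x N.+1)^-1 = E (-1) by rewrite absV xabs qexpN.
  have H0E : H 0%N = (lam^-1)%:P * 'X^(L - 2) by exact: period_coef0.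
  have topE : H 0%N * 'X^2 + B * 'X + H L.-1 = (1 + lam^-1)%:P * 'X^L + H L.-1.
    rewrite H0E -mulrA -exprD /B -exprSr (_ : (L - 2 + 2 = L)%N); last by lia.
    by rewrite (_ : (L - 1).+1 = L); [rewrite polyCD; ring|lia].
  have s1 : size ((1 + lam^-1)%:P * 'X^L) = L.+1.
    by rewrite size_Cmul ?size_polyXn // nu_neq0.
  have stop : size (H 0%N * 'X^2 + B * 'X + H L.-1) = L.+1.
    rewrite topE size_polyDl s1 // ltnS.
    by apply: leq_trans (size_period_coef_le _ _) _; lia.
  have topN : abs (emb (H 0%N * 'X^2 + B * 'X + H L.-1)) = E L%:R.
    by rewrite abs_emb -?size_poly_gt0 /pdeg stop.
  rewrite absD_dom topN //; apply: (@le_lt_trans _ _ (E (L%:R - 1))); last first.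
    by rewrite ltr_qexp; lra.
  have L2 : 1 <= L%:R :> R by rewrite ler1n.
  apply: absD_le.
    apply: (@le_trans _ _ (E (L%:R + 2 * -1))); last by rewrite ler_qexp; lra.
    apply: absM_le; last by apply: absX_le; rewrite tE.
    apply: abs_emb_le; rewrite ler_nat.
    by have := @size_period_coef_le _ lam e 0 isT; rewrite -/H -/L; lia.
  apply: absM_le; last by rewrite tE.
  by apply: abs_emb_le; rewrite /pdeg /B size_polyXn ler_nat; lia.
have B0 : B != 0 by rewrite -size_poly_gt0 size_polyXn.
have gM1 : g M.+1 != 0 by rewrite -size_poly_gt0 size_gM1; lia.
have szM1 : (size (g M.+1) + 2 = size (g M))%N by rewrite size_gM1 size_gM; lia.
have szB : (size B <= size (g M))%N by rewrite size_gM /B size_polyXn; lia.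
have [a [c []]] := forms_from_base p_size xE xabs F2 (ltnW MN) B0 chain gM1 szM1 szB uni fN.
rewrite x0 size_gM (_ : M%:R = n0%:R - P%:R :> R); last by rewrite natrB.
move=> u1 u2 u3 u4; exists a, c; split=> //.
- by rewrite u2; congr E; rewrite -natr1; ring.
- by rewrite u3 -natr1; ring.
Qed.

(** Multiplying by r - 1 clears the geometric sum: (r - 1) h k = D r^k - 2l for the logarithmic
    height h. Comparing with the degree r^(k+1) - 1 of the middle coefficient gives 1 - v = r(r - 1)
    / D, and comparing with the exponent of the value gives w + v. *)
Lemma constant_head_exponents (rr := r%:R : R) (D := 2 * l%:R * rr + (rr - 1) * (rr - 2))
    (w := rr - 1 - rr * (rr - 1) * (rr - 4) / D)
    (v := 1 - rr * (rr - 1) / D : R) n : (2 <= n)%N ->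
  [/\ 1 < w, 0 <= v, v <= 1 &
  ((w%:E <= wnstar n xi)%E /\ ((w + v)%:E <= wn n xi)%E) /\
  (0 < 1 + w + v - n%:R ->
   2 * rr * (n%:R - v) <= (1 + w + v - n%:R) * (w - 1) ->
   wnstar n xi = w%:E /\ wn n xi = (w + v)%:E)].
Proof.
move=> n2.
have p_size j : size (p j) = 2%N by exact: size_CX.
have [x [x0 xE xabs]] := complete_quotients p_size xi_lim.
have bad : badly_approximable xi.
  by rewrite -x0; exact: (@complete_quotient_badly_approximable F R V p x xE xabs 0%N).
have /choice [a /choice [c ac]] k := constant_head_forms k x0 xE xabs.
have l1 : 1 <= l%:R :> R by rewrite ler1n.
have r2 : 2 <= rr by rewrite (ler_nat R 2).
have lr : 2 <= l%:R * rr by rewrite -[2]mul1r ler_pM //; lra.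
have rr2 : 0 <= (rr - 1) * (rr - 2) by apply: mulr_ge0; lra.
have D0 : 0 < D by rewrite /D; lra.
have Dn0 : D != 0 by rewrite gt_eqF.
have w1 : 1 < w.
  rewrite /w -subr_gt0.
  have -> : rr - 1 - rr * (rr - 1) * (rr - 4) / D - 1 =
    (2 * (l%:R * rr) * (rr - 2) + 4 * (rr - 1)) / D.
    by move: Dn0; rewrite /D => Dn0'; field.
  rewrite divr_gt0 //.
  have : 0 <= (l%:R * rr) * (rr - 2) by apply: mulr_ge0; lra.
  lra.
have v0 : 0 <= v.
  rewrite /v subr_ge0 ler_pdivrMr // mul1r /D.
  have : 0 <= (l%:R - 1) * rr by apply: mulr_ge0; lra.
  lra.
have v1 : v <= 1.
  rewrite /v lerBlDr lerDl divr_ge0 ?(ltW D0) //; apply: mulr_ge0; lra.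
split=> //.
have sk k : (rr - 1) * (start k.+1)%:R = l%:R * (rr * (r ^ k)%:R - 1).
  by rewrite (level_startR l r_gt0) exprS -natrX.
pose h k : R := (r ^ k.+1)%:R + 2 * ((start k.+1)%:R - (r ^ k)%:R).
have hk k : (rr - 1) * h k = D * (r ^ k)%:R - 2 * l%:R.
  have -> : (rr - 1) * h k =
      (rr - 1) * (rr * (r ^ k)%:R - 2 * (r ^ k)%:R) + 2 * ((rr - 1) * (start k.+1)%:R).
    by rewrite /h expnS natrM -/rr; ring.
  by rewrite sk /D; ring.
have r10 : rr - 1 != 0 by apply: lt0r_neq0; lra.
have wvE : w + v = (2 * l%:R * rr ^+ 2 + rr * (rr - 1)) / D.
  by rewrite /w /v; move: Dn0; rewrite /D => Dn0; field.
(* With [c1], the additive errors of these comparisons; they are independent of k. *)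
pose c0 := 2 * l%:R * (w + v - 1) / (rr - 1).
pose c1 := 2 * l%:R * rr / D.
have epE k : (r ^ k.+1)%:R - 2 * (start k.+1 + l.+1 * r ^ k.+1)%N%:R =
    - (w + v) * h k - c0.
  apply: (@mulfI _ (rr - 1)) => //.
  have -> : (rr - 1) * (- (w + v) * h k - c0) =
    - (w + v) * ((rr - 1) * h k) - 2 * l%:R * (w + v - 1).
    by rewrite /c0; field.
  have -> : (rr - 1) * ((r ^ k.+1)%:R - 2 * (start k.+1 + l.+1 * r ^ k.+1)%N%:R) =
    (rr - 1) * (rr * (r ^ k)%:R) * (1 - 2 * (l%:R + 1)) - 2 * ((rr - 1) * (start k.+1)%:R).
    by rewrite natrD natrM expnS natrM -/rr -natr1; ring.
  rewrite hk sk wvE; move: (Dn0); rewrite /D => Dn0'.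
  by field.
have ebE k : (r ^ k.+1)%:R - 1 = (1 - v) * h k + c1 - 1.
  apply: (@mulfI _ (rr - 1)) => //.
  have -> : (rr - 1) * ((1 - v) * h k + c1 - 1) =
    (1 - v) * ((rr - 1) * h k) + (rr - 1) * (c1 - 1) by ring.
  by rewrite hk /v /c1 expnS natrM -/rr; field.
have c0_ge0 : 0 <= c0.
  by rewrite /c0; apply: divr_ge0; [apply: mulr_ge0|]; lra.
have c1_ge0 : 0 <= c1.
  by rewrite /c1; apply: divr_ge0; lra.
pose K := 2 + c0 + c1 + 2 * l%:R.
have geP k : (r ^ k)%:R <= (start k.+1)%:R :> R.
  by rewrite ler_nat level_start_next (leq_trans _ (leq_addl _ _)) // leq_pmull.
apply: (@exponents_of_forms F R V xi a (fun k => 'X^(r ^ k.+1 - 1)) c w v rr K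
  (fun k => h k - 2) (fun k => (r ^ k.+1)%:R - 1)
  (fun k => (r ^ k.+1)%:R - 2 * (start k.+1 + l.+1 * r ^ k.+1)%N%:R)) => //.
- by rewrite /K; lra.
- by apply: lt_trans w1.
- by apply: lt_le_trans w1 _; rewrite lerDl.
- by rewrite -x0 xabs ler_qexp /K; lra.
- by move=> k; have [] := ac k.
- by move=> k; have [_ -> _ _] := ac k; congr E; rewrite /h; ring.
- move=> k; rewrite abs_emb -?size_poly_gt0 /pdeg size_polyXn //=.
  by rewrite natrB // expn_gt0 r_gt0.
- by move=> k; have [] := ac k.
- by move=> k; have [_ _ -> _] := ac k; rewrite -/(h k) /K; apply/andP; split; lra.
- move=> k; have [_ _ -> _] := ac k; rewrite -/(h k) ebE /K.
  by apply/andP; split; lra.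
- move=> k; have [_ _ -> _] := ac k; rewrite -/(h k) epE /K.
  by apply/andP; split; lra.
- move=> k; have [_ _ -> _] := ac k; have [_ _ -> _] := ac k.+1.
  rewrite -/(h k) -/(h k.+1).
  have -> : h k.+1 = rr * h k + 2 * l%:R.
    apply: (@mulfI _ (rr - 1)) => //.
    have -> : (rr - 1) * (rr * h k + 2 * l%:R) =
      rr * ((rr - 1) * h k) + (rr - 1) * (2 * l%:R) by ring.
    by rewrite !hk expnS natrM -/rr; ring.
  by rewrite /K; lra.
- move=> M; exists (Num.truncn M).+1 => k kM; have [_ _ -> _] := ac k.
  have hM : M < (Num.truncn M).+1%:R by exact: truncnS_gt.
  have : (Num.truncn M).+1%:R <= (r ^ k.+1)%:R :> R.
    rewrite ler_nat (leq_trans kM) // (leq_trans (leqnSn k)) // ltnW //.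
    exact: ltn_expl.
  by have := geP k; lra.
Qed.

End ConstantHead.

(** * The numerical hypotheses on d and the two cases of the theorem *)

Lemma card_pow2_char2 (F : finFieldType) s : #|F| = (2 ^ s)%N -> 2%:R = 0 :> F.
Proof.
by move=> cF; rewrite -(pcharf0 (card_finPcharP cF isT)).
Qed.

(** The hypothesis puts w at or above the larger root of X^2 - d X - ((2r - 1) d + 1). This suffices
    for n = d, and a smaller n only relaxes the conclusion. *)
Lemma sqrt_condition (R : realType) (l m r d n : R) (w := m / l * (r - 1)) :
  0 < l -> 0 < m -> 1 < r -> 2 <= d -> 2 <= n -> n <= d ->
  l / m <= 2 * (r - 1) / (d + Num.sqrt (d ^+ 2 + 4 * (2 * r - 1) * d + 4)) ->
  0 < 1 + w + 1 - n /\ 2 * r * (n - 1) <= (1 + w + 1 - n) * (w - 1).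
Proof.
move=> l0 m0 r1 d2 n2 nd; set S := d ^+ 2 + _ + 4; set q := Num.sqrt S.
have rd : 0 <= (2 * r - 1) * d by apply: mulr_ge0; lra.
have S0 : 0 <= S by rewrite /S; have := sqr_ge0 d; lra.
have q0 : 0 <= q by exact: sqrtr_ge0.
have qS : q ^+ 2 = S by rewrite sqr_sqrtr.
rewrite ler_pdivlMr; last by lra.
rewrite mulrAC ler_pdivrMr // => le1.
have le2 : d + q <= 2 * w.
  rewrite /w -(ler_pM2l l0); apply: le_trans le1 _.
  by rewrite le_eqVlt; apply/orP; left; apply/eqP; field; rewrite gt_eqF.
have dq : d <= q by rewrite -(ler_pXn2r (n := 2)) ?nnegrE //; [rewrite qS /S; lra|lra].
have : q ^+ 2 <= (2 * w - d) ^+ 2 by rewrite lerXn2r ?nnegrE //; lra.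
rewrite qS /S => le3; clearbody w.
have le4 : (2 * r - 1) * d + 1 <= w ^+ 2 - w * d by move: le3; rewrite sqrrB; lra.
split; first by lra.
have le5 : 0 <= (d - n) * (w - 1) by apply: mulr_ge0; lra.
have le6 : 0 <= r * (d - n) by apply: mulr_ge0; lra.
move: le4 le5 le6; rewrite expr2; lra.
Qed.

(** For w = r - 1 - e the last hypothesis is the second conclusion at n = d, v = 0; decreasing n or
    increasing v only weakens it. *)
Lemma product_condition (R : realType) (r d n e v : R) :
  0 < r -> 0 < d -> n <= d -> 1 < r - 1 - e -> 0 <= v ->
  2 * r * d <= (r - 2 - e) * (r - d - e) ->
  0 < 1 + (r - 1 - e) + v - n /\
  2 * r * (n - v) <= (1 + (r - 1 - e) + v - n) * (r - 1 - e - 1).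
Proof.
move=> r0 d0 nd w1 v0 le1.
have a0 : 0 < r - 2 - e by lra.
have rd : 0 < r * d by rewrite mulr_gt0.
have b0 : 0 < r - d - e by rewrite -(pmulr_rgt0 _ a0); apply: lt_le_trans le1; lra.
have h1 : 0 <= (r - 2 - e) * (d - n) by apply: mulr_ge0; lra.
have h2 : 0 <= (r - 2 - e) * v by apply: mulr_ge0; lra.
have h3 : 0 <= r * (d - n) by apply: mulr_ge0; lra.
have h4 : 0 <= r * v by apply: mulr_ge0; lra.
by split; lra.
Qed.

Theorem theorem3p4 (R : realType) (F : finFieldType) (V : valued_closure F R)
  (s t l m d : nat) (lam0 eps1 eps2 : F) (lam : nat -> F) (Phi : V) :
  (1 <= s)%N -> (1 <= t)%N -> #|F| = (2 ^ s)%N ->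
  (1 <= l)%N -> (1 <= m)%N -> (2 <= d)%N -> (m <= l)%N ->
  lam0 != 0 -> lam0 != 1 ->
  (forall i, (1 <= i <= l)%N -> lam i != 0) -> eps1 != 0 -> eps2 != 0 ->
  (forall m' : nat, lam (l + 2 ^ t * m' + 1)%N =
     (eps2 / eps1) * eps2 ^ ((-1) ^+ m'.+1 : int) * lam m'.+1 ^+ (2 ^ t)) ->
  (forall m' i : nat, (2 <= i <= 2 ^ t)%N ->
     lam (l + 2 ^ t * m' + i)%N = (eps1 / eps2) ^ ((-1) ^+ i : int)) ->
  cf_limit (fun i => (lam i.+1)%:P * 'X) Phi ->
  (* part (1) *)
  (lam 1%N = lam0 -> (forall i, (2 <= i <= m)%N -> lam i = 1) ->
   eps1 = 1 -> eps2 = 1 -> ((m < l)%N -> lam m.+1 != 1) ->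
   (((m%:R / l%:R * ((2 ^ t)%:R - 1) : R)%:E <= wnstar 2 Phi)%E /\
    ((1 + m%:R / l%:R * ((2 ^ t)%:R - 1) : R)%:E <= wn 2 Phi)%E) /\
   ((l%:R / m%:R : R) <= 2 * ((2 ^ t)%:R - 1) /
       (d%:R + Num.sqrt (d%:R ^+ 2 + 4 * (2 * (2 ^ t)%:R - 1) * d%:R + 4)) ->
    forall n : nat, (2 <= n <= d)%N ->
      wnstar n Phi = (m%:R / l%:R * ((2 ^ t)%:R - 1) : R)%:E /\
      wn n Phi = (1 + m%:R / l%:R * ((2 ^ t)%:R - 1) : R)%:E)) /\
  (* part (2) *)
  ((exists k : nat, (2 ^ t)%N = (#|F| ^ k)%N) -> eps1 = 1 -> eps2 = 1 ->
   (forall i, (1 <= i <= l)%N -> lam i = lam0) ->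
   let r : R := (2 ^ t)%:R in
   let D : R := 2 * l%:R * r + (r - 1) * (r - 2) in
   (((r - 1 - r * (r - 1) * (r - 4) / D)%:E <= wnstar 2 Phi)%E /\
    ((r - r * (r - 1) * (r - 3) / D)%:E <= wn 2 Phi)%E) /\
   (2 * r * d%:R <= (r - 2 - r * (r - 1) * (r - 4) / D) *
                    (r - d%:R - r * (r - 1) * (r - 4) / D) ->
    forall n : nat, (2 <= n <= d)%N ->
      wnstar n Phi = (r - 1 - r * (r - 1) * (r - 4) / D)%:E /\
      wn n Phi = (r - r * (r - 1) * (r - 3) / D)%:E)).
Proof.
move=> s0 t0 cF l0 m0 d2 ml lam00 lam01 lam_nz e1_nz e2_nz rec1 rec2 lim.
have F2 := card_pow2_char2 cF.
(* Counting from 0 turns the recurrence into self-similarity under i -> l + r i. *)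
pose mu i := lam i.+1.
have r_gt0 : (0 < 2 ^ t)%N by rewrite expn_gt0.
have r_gt1 : (1 < 2 ^ t)%N by rewrite -(expn0 2) ltn_exp2l.
have head : eps1 = 1 -> eps2 = 1 -> forall i, mu (l + 2 ^ t * i)%N = mu i ^+ (2 ^ t).
  by move=> e1 e2 i; rewrite /mu -addn1 rec1 e1 e2 divr1 exp1rz !mul1r.
have tail : eps1 = 1 -> eps2 = 1 ->
    forall i j, (0 < j < 2 ^ t)%N -> mu (l + 2 ^ t * i + j)%N = 1.
  by move=> e1 e2 i j hj; rewrite /mu -addnS rec2 // e1 e2 divr1 exp1rz.
have mu_nz : eps1 = 1 -> eps2 = 1 -> forall i, mu i != 0.
  move=> e1 e2; apply: (mu_neq0 l0 r_gt0 (head e1 e2) (tail e1 e2)) => i il.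
  exact: lam_nz.
have lR : 0 < l%:R :> R by rewrite ltr0n.
have mR : 0 < m%:R :> R by rewrite ltr0n.
have rR : 1 < (2 ^ t)%:R :> R by rewrite ltr1n.
have dR : 2 <= d%:R :> R by rewrite (ler_nat R 2).
split.
  move=> lam1 lam_i e1 e2 lam_m.
  have mu00 : mu 0 != 1 by rewrite /mu lam1.
  have mum : mu m != 1.
    (* If m = l, the letter after the ones is mu 0 ^+ r, still different from 1. *)
    move: ml; rewrite leq_eqVlt => /orP[/eqP -> | /lam_m //].
    by have := head e1 e2 0%N; rewrite muln0 addn0 => ->; rewrite char2_expr2n_eq1.
  have mu1 i : (0 < i < m)%N -> mu i = 1 by move=> im; apply: lam_i.
  have main := initial_ones_exponents l0 t0 F2 (head e1 e2) (tail e1 e2) (mu_nz e1 e2)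
    lim m0 mu00 mum mu1.
  split; first by have [+ _] := main 2 isT; rewrite [_ + 1]addrC.
  move=> cond n /andP[n2 nd].
  have n2R : 2 <= n%:R :> R by rewrite (ler_nat R 2).
  have ndR : n%:R <= d%:R :> R by rewrite ler_nat.
  have [D0 Dw] := sqrt_condition lR mR rR dR n2R ndR cond.
  by have [_ /(_ D0 Dw)] := main n n2; rewrite [_ + 1]addrC.
move=> [k rq] e1 e2 lam_c r D.
have lamr : lam0 ^+ (2 ^ t) = lam0.
  rewrite rq; elim: k {rq} => [|k IH]; first by rewrite expn0 expr1.
  by rewrite expnSr exprM IH expf_card.
have mu_c i : (i < l)%N -> mu i = lam0 by move=> il; apply: lam_c.
have main := constant_head_exponents l0 t0 F2 (head e1 e2) (tail e1 e2) (mu_nz e1 e2) lim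
  lam00 lam01 lamr mu_c.
have D0 : D != 0.
  have h1 : 0 < l%:R * r by apply: mulr_gt0 => //; apply: lt_trans rR.
  have h2 : 0 <= (r - 1) * (r - 2).
    apply: mulr_ge0; first by rewrite /r; lra.
    by rewrite subr_ge0 (ler_nat R 2).
  by apply: lt0r_neq0; rewrite /D; lra.
(* The last summand is the far-root exponent v. *)
have wvE : r - r * (r - 1) * (r - 3) / D =
    (r - 1 - r * (r - 1) * (r - 4) / D) + (1 - r * (r - 1) / D) by field.
rewrite wvE; split; first by have [_ _ _ []] := main 2 isT.
move=> cond n /andP[n2 nd].
have ndR : n%:R <= d%:R :> R by rewrite ler_nat.
have [w1 v0 v1 [_ ]] := main n n2.
have r0 : 0 < r by apply: lt_trans rR.
have d0 : 0 < d%:R :> R by apply: lt_le_trans dR.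
have [D1 Dw] := product_condition r0 d0 ndR w1 v0 cond.
by apply.
Qed.
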